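(* For every $g\ge3$, $$\begin{aligned}\widetilde\chi_{g,0}(\kappa)=\frac{B_{2g}}{2g(2g-2)}+\frac12\int_0^\kappa\Big[&\Big((3-2g)+\kappa^2\frac{\partial}{\partial\kappa}+2\kappa-\frac16\Big)\Big((4-2g)+\kappa^2\frac{\partial}{\partial\kappa}\Big)\widetilde\chi_{g-1,0}\\&+\sum_{r=2}^{g-2}\Big((2-2r)+\kappa^2\frac{\partial}{\partial\kappa}\Big)\widetilde\chi_{r,0}\cdot\Big((2-2g+2r)+\kappa^2\frac{\partial}{\partial\kappa}\Big)\widetilde\chi_{g-r,0}\Big]d\kappa.\end{aligned}$$
   Context: $B_{2g}$ are the Bernoulli numbers. Stable graphs: a stable graph is a finite graph (loops and multiple edges allowed) with internal edges, each joining two (possibly equal) vertices, and unlabelled external edges, each attached to one vertex. Each vertex $v$ carries a genus $g_v\in\mathbb Z_{\ge0}$; its valence $\mathrm{val}_v$ is the number of half-edges at $v$ (an external edge counts once, a loop twice); stability means $2g_v-2+\mathrm{val}_v>0$ for every $v$. The genus of a connected stable graph $\Gamma$ is $h^1(\Gamma)+\sum_v g_v$. $\mathcal G^c_{g,n}$ is the (finite) set of isomorphism classes of connected stable graphs of genus $g$ with $n$ external edges, $V(\Gamma)$ and $E(\Gamma)$ are the sets of vertices and internal edges, and $\mathrm{Aut}(\Gamma)$ is the automorphism group (acting on vertices and half-edges; external edges may be permuted). For $2g-2+n>0$, $\chi(\mathcal M_{g,n})$ is the orbifold Euler characteristic of the moduli space of smooth genus $g$ curves with $n$ marked points, given by the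 Harer–Zagier formula $\chi(\mathcal M_{g,n})=(-1)^n\frac{(2g-1)B_{2g}}{(2g)!}(2g+n-3)!$. The refined orbifold Euler characteristic (at $t=1$) is the polynomial $$\widetilde\chi_{g,n}(\kappa):=\sum_{\Gamma\in\mathcal G^c_{g,n}}\frac{\kappa^{|E(\Gamma)|}}{|\mathrm{Aut}(\Gamma)|}\prod_{v\in V(\Gamma)}\chi(\mathcal M_{g_v,\mathrm{val}_v}).$$ *)

(* Defs.v *)
From HB Require Import structures.
From mathcomp Require Import all_boot all_order perm all_algebra.
From mathcomp Require Import boolp classical_sets cardinality fsbigop.

Set Implicit Arguments.
Unset Strict Implicit.
Unset Printing Implicit Defensive.

Import Order.TTheory GRing.Theory Num.Theory.
Local Open Scope quotient_scope.
Local Open Scope ring_scope.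

(** * Bernoulli numbers, with the convention B_1 = -1/2 *)

(* bernoulli_seq n = [:: B_0; ...; B_n] *)
Fixpoint bernoulli_seq (n : nat) : seq rat :=
  if n is m.+1 then
    let s := bernoulli_seq m in
    rcons s (- (m.+2%:R)^-1 * \sum_(k < m.+1) 'C(m.+2, k)%:R * s`_k)
  else [:: 1].

Definition bernoulli (n : nat) : rat := (bernoulli_seq n)`_n.

Lemma size_bernoulli_seq n : size (bernoulli_seq n) = n.+1.
Proof. by elim: n => //= n IHn; rewrite size_rcons IHn. Qed.

Lemma nth_bernoulli_seq n k : (k <= n)%N -> (bernoulli_seq n)`_k = bernoulli k.
Proof.
elim: n => [|n IHn]; first by rewrite leqn0 => /eqP ->.
rewrite leq_eqVlt => /orP[/eqP -> //|lt_kn].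
by rewrite /= nth_rcons size_bernoulli_seq lt_kn IHn.
Qed.

Lemma bernoulli0 : bernoulli 0 = 1.
Proof. by []. Qed.

Lemma bernoulli_rec n :
  \sum_(k < n.+2) 'C(n.+2, k)%:R * bernoulli k = 0 :> rat.
Proof.
rewrite big_ord_recr /= binSn.
rewrite [bernoulli n.+1]/bernoulli /= nth_rcons size_bernoulli_seq ltnn eqxx.
rewrite mulrA mulrN mulfV ?pnatr_eq0 // mulN1r.
apply/eqP; rewrite subr_eq0; apply/eqP; apply: eq_bigr => k _.
by rewrite nth_bernoulli_seq // -ltnS.
Qed.

(** * Orbifold Euler characteristic of M_{g,n} (Harer-Zagier) *)

(* Meaningful for 2 < 2 * g + n, in which case the truncated subtraction is
   a genuine one. *)
Definition chi_M (g n : nat) : rat :=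
  (-1) ^+ n * (((2 * g)%:R - 1) * bernoulli (2 * g) / ((2 * g)`!)%:R)
  * ((2 * g + n - 3)`!)%:R.

(** * Stable graphs *)

(* A graph is given by its vertices 'I_sg_nv, its half-edges 'I_sg_nh, the
   vertex carrying each half-edge and an involution on half-edges: its
   two-element orbits are the internal edges, its fixed points the external
   edges.  Up to isomorphism every finite graph has this form. *)
Record stable_graph : Type := StableGraph {
  sg_nv : nat;
  sg_nh : nat;
  sg_genus : {ffun 'I_sg_nv -> nat};
  sg_root : {ffun 'I_sg_nh -> 'I_sg_nv};
  sg_opp : {ffun 'I_sg_nh -> 'I_sg_nh};
  sg_oppK : involutive sg_opp;
  sg_stable : forall v : 'I_sg_nv,
    (2 < 2 * sg_genus v + #|[set h | sg_root h == v]|)%N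
}.

HB.instance Definition _ := gen_eqMixin stable_graph.
HB.instance Definition _ := gen_choiceMixin stable_graph.

Section StableGraph.
Variable G : stable_graph.

Definition valence (v : 'I_(sg_nv G)) : nat := #|[set h | sg_root G h == v]|.

Definition edges : {set {set 'I_(sg_nh G)}} :=
  [set [set h; sg_opp G h] | h in [set h | sg_opp G h != h]].

Definition external_edges : {set 'I_(sg_nh G)} := [set h | sg_opp G h == h].

Definition adjacent : rel 'I_(sg_nv G) :=
  [rel v w | [exists h, (sg_root G h == v) && (sg_root G (sg_opp G h) == w)]].

Definition connected_graph : Prop :=
  (0 < sg_nv G)%N /\ forall v w, connect adjacent v w.

(* The coboundary C^0 -> C^1, acting on row vectors:
   (f *m coboundary) h = f (other end of h) - f (root of h).
   C^1 consists of the functions on the internal half-edges which are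
   antisymmetric under sg_opp, so dim C^1 = #|edges|.  The columns of external
   half-edges vanish. *)
Definition coboundary : 'M[rat]_(sg_nv G, sg_nh G) :=
  \matrix_(v, h) ((sg_root G (sg_opp G h) == v)%:R - (sg_root G h == v)%:R).

(* dim H^1 = dim C^1 - rank of the coboundary *)
Definition h1 : nat := #|edges| - \rank coboundary.

Definition graph_genus : nat := h1 + \sum_v sg_genus G v.

End StableGraph.

Definition graph_morphism (G1 G2 : stable_graph)
    (s : 'I_(sg_nv G1) -> 'I_(sg_nv G2))
    (t : 'I_(sg_nh G1) -> 'I_(sg_nh G2)) : bool :=
  [&& [forall v, sg_genus G2 (s v) == sg_genus G1 v],
      [forall h, sg_root G2 (t h) == s (sg_root G1 h)]
    & [forall h, sg_opp G2 (t h) == t (sg_opp G1 h)]].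

Definition isomorphic (G1 G2 : stable_graph) : Prop :=
  exists s t, [/\ bijective s, bijective t & @graph_morphism G1 G2 s t].

Definition automorphisms (G : stable_graph) :
    {set {perm 'I_(sg_nv G)} * {perm 'I_(sg_nh G)}} :=
  [set st : {perm 'I_(sg_nv G)} * {perm 'I_(sg_nh G)}
     | @graph_morphism G G st.1 st.2].

Lemma isomorphic_refl G : isomorphic G G.
Proof.
exists id, id; split; try by exists id.
by apply/and3P; split; apply/forallP => x.
Qed.

Lemma isomorphic_sym G1 G2 : isomorphic G1 G2 -> isomorphic G2 G1.
Proof.
move=> [s [t [[s' sK s'K] [t' tK t'K] /and3P[/forallP gE /forallP rE /forallP oE]]]].
exists s', t'; split; [by exists s | by exists t |].
apply/and3P; split; apply/forallP => x.
- by rewrite -(eqP (gE _)) s'K.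
- by rewrite -(can_eq sK) -(eqP (rE _)) t'K s'K.
- by rewrite -(can_eq tK) -(eqP (oE _)) !t'K.
Qed.

Lemma isomorphic_trans G2 G1 G3 :
  isomorphic G1 G2 -> isomorphic G2 G3 -> isomorphic G1 G3.
Proof.
move=> [s [t [bs bt /and3P[/forallP gE /forallP rE /forallP oE]]]].
move=> [s' [t' [bs' bt' /and3P[/forallP gE' /forallP rE' /forallP oE']]]].
exists (s' \o s), (t' \o t); split; [exact: bij_comp | exact: bij_comp |].
apply/and3P; split; apply/forallP => x /=.
- by rewrite (eqP (gE' _)).
- by rewrite (eqP (rE' _)) (eqP (rE _)).
- by rewrite (eqP (oE' _)) (eqP (oE _)).
Qed.

Definition isomorphicb : rel stable_graph :=
  [rel G1 G2 | `[< isomorphic G1 G2 >]].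

Lemma isomorphicb_refl : reflexive isomorphicb.
Proof. by move=> G; apply/asboolP/isomorphic_refl. Qed.

Lemma isomorphicb_sym : symmetric isomorphicb.
Proof. by move=> G1 G2; apply/asboolP/asboolP => /isomorphic_sym. Qed.

Lemma isomorphicb_trans : transitive isomorphicb.
Proof.
move=> G2 G1 G3 /asboolP h12 /asboolP h23; apply/asboolP.
exact: isomorphic_trans h12 h23.
Qed.

Canonical isomorphicb_equiv :=
  EquivRel isomorphicb isomorphicb_refl isomorphicb_sym isomorphicb_trans.

Notation iso_class := {eq_quot isomorphicb}.

(** * Refined orbifold Euler characteristic *)

Definition connected_stable_graphs (g n : nat) : set iso_class :=
  [set C | [/\ connected_graph (repr C), graph_genus (repr C) = g
             & #|external_edges (repr C)| = n]]%classic.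

Definition graph_weight (G : stable_graph) : {poly rat} :=
  ((#|automorphisms G|%:R)^-1 * \prod_(v < sg_nv G) chi_M (sg_genus G v) (valence v))
    *: 'X^(#|edges G|).

(* The variable 'X plays the role of kappa.  This is a sum over a set of
   isomorphism classes, in the sense of fsbigop: it is the usual finite sum
   because connected_stable_graphs g n is finite. *)
Definition refined_chi (g n : nat) : {poly rat} :=
  \sum_(C \in connected_stable_graphs g n) graph_weight (repr C).

(** * Operators on polynomials in kappa *)

(* a + kappa^2 d/dkappa, where a acts by multiplication *)
Definition kappa_op (a p : {poly rat}) : {poly rat} := a * p + 'X^2 * p^`().

(* the integral of p from 0 to kappa, as a polynomial in kappa *)
Definition poly_integral (p : {poly rat}) : {poly rat} :=
  'X * \poly_(i < size p) (p`_i / i.+1%:R).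

Lemma poly_integral0 p : (poly_integral p).[0] = 0.
Proof. by rewrite /poly_integral hornerM hornerX mul0r. Qed.

Lemma deriv_poly_integral p : (poly_integral p)^`() = p.
Proof.
apply/polyP => i; rewrite coef_deriv coefXM /= coef_poly.
case: ltnP => [_|le_pi]; last by rewrite mul0rn nth_default.
by rewrite -[LHS]mulr_natr divfK // pnatr_eq0.
Qed.

(* Main.v *)
Require Import Defs.
From mathcomp Require Import all_fingroup.
From mathcomp Require Import all_boot all_order all_algebra.
From mathcomp Require Import ring lra zify.
From mathcomp Require Import boolp.
From mathcomp Require classical_sets fsbigop.

Set Implicit Arguments.
Unset Strict Implicit.
Unset Printing Implicit Defensive.

Import GRing.Theory Num.Theory.
Local Open Scope quotient_scope.
Local Open Scope ring_scope.

(** The recursion comes from cutting an edge.  Count connected stable graphs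
    with all numbers n of external edges at once, weighted by the product of
    the chi_M over the order of the automorphism group, and grade them by
    d = 2g - 2 + n.  This grading is additive: it is the sum over the vertices
    of 2 g_v - 2 + val_v, every term of which is positive by stability, and it
    is unchanged when an edge is cut into two external edges.  Let f_d be the
    resulting polynomial in x and kappa, where x counts external edges and
    kappa internal ones; the coefficient of x^n in f_(2g-2+n) is the refined
    Euler characteristic of type (g, n).

    Cutting a marked edge leaves either a connected graph with two more
    external edges or two connected graphs with one more each, so
      2 d/dkappa f_d = f_d'' + sum_(i <= d) f_i' f_(d-i)',
    the primes being derivatives in x; this is gf_cut.  At kappa = 0
    only the one-vertex graphs remain.

    To eliminate the external edges one needs the effect of adding one,
      f_(d+1)' = - d f_d + x kappa f_d' + kappa^2 d/dkappa f_d + source,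
    where the source x^2/2 + kappa/2 - 1/12 is present for d = 0 only.  No
    bijection on graphs is used for it: the difference of the two sides
    satisfies the linearization of the cut equation at f (leg_defect_pde), and
    it vanishes at kappa = 0 because the Harer-Zagier formula gives
    chi_M g (n+1) = - (2g - 2 + n) chi_M g n, the coefficients 1/2 and -1/12 of
    the source at kappa = 0 being chi_M 0 3 / 2 and chi_M 1 1.  Hence it vanishes identically (leg_defect0).

    Reading this identity at x^0 and x^1 writes the coefficients with one and
    two external edges as operators on those with none.  Substituted in the
    x^0 coefficient of the cut equation they give the derivative of the
    theorem (closed_part_rec).  In the terms r = 1 and r = g - 1 one factor
    is of type (1, 1) and equals kappa/2 - 1/12, because the type (1, 0) is
    unstable; together they turn + kappa into + 2 kappa - 1/6.

    What links these polynomials to the sum over isomorphism classes is orbit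
    counting: a class with V vertices and H half-edges is represented by
    V! H! / |Aut| labelled graphs (card_isomorphic_labelled).  For labelled
    graphs cutting an edge changes nothing but the involution on half-edges,
    and distributing vertices and half-edges over two components produces the
    binomial coefficients that the factorials absorb. *)

(** * Sums over finite types *)

(** Reindexing along a one-to-one relation rather than a function: the inverse
    of most bijections below exists but is awkward to write down. *)
Lemma sum_correspondence (R : nmodType) (I J : finType) (r : I -> J -> bool)
    (P : pred I) (Q : pred J) (F : I -> R) (G : J -> R) :
  (forall i, P i -> exists j, r i j) -> (forall j, Q j -> exists i, r i j) ->
  (forall i j, r i j -> P i = Q j) ->
  (forall i j j', r i j -> r i j' -> j = j') ->
  (forall i i' j, r i j -> r i' j -> i = i') ->
  (forall i j, P i -> r i j -> F i = G j) ->
  \sum_(i | P i) F i = \sum_(j | Q j) G j.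
Proof.
move=> rl rr rPQ fr fl FG.
transitivity (\sum_(i | P i) \sum_(j | r i j) G j).
  apply: eq_bigr => i Pi; have [j rij] := rl _ Pi.
  rewrite (big_pred1 j) ?(FG i j) // => j' /=.
  by apply/idP/eqP => [|->//]; move/(fr _ _ _ rij).
rewrite (exchange_big_dep Q) /=; last by move=> i j Pi /rPQ <-.
apply: eq_bigr => j Qj; have [i rij] := rr _ Qj.
rewrite (big_pred1 i) // => i' /=.
apply/andP/eqP => [[_ ri'j]|->]; first exact: fl ri'j rij.
by rewrite (rPQ _ _ rij).
Qed.

Lemma sum_neq0 (R : nmodType) (I : finType) (F : I -> R) :
  \sum_i F i != 0 -> exists i, F i != 0.
Proof.
move=> s0; apply/existsP; apply: contraNT s0 => /existsPn F0.
by rewrite big1 // => i _; have /negPn/eqP := F0 i.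
Qed.

(** * Graphs on fixed vertices and half-edges, and cutting an edge *)

Section Gluings.
Variables V H : finType.

(** The endpoint of each half-edge, and the permutation whose two-cycles are
    the internal edges and whose fixed points are the external ones; this is a
    graph when the permutation is involutive. *)
Definition gluing : finType := ({ffun H -> V} * {perm H})%type.

Implicit Types (x : gluing) (S U : {set V}) (h : H).

Definition closed_set x S := [forall h, (x.1 (x.2 h) \in S) == (x.1 h \in S)].

(** Minimal nonempty closed set of vertices: connectivity without paths, so
    that it can be transported and restricted by set algebra alone. *)
Definition component x S :=
  [&& S != set0, closed_set x S &
      [forall U : {set V}, (U \subset S) && closed_set x U ==> (U == set0) || (U == S)]].

Definition legs x : {set H} := [set h | x.2 h == h].

Definition involutiveb x := [forall h, x.2 (x.2 h) == h].

Definition graph_on n x :=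
  [&& involutiveb x, component x setT & #|legs x| == n].

(** On two external half-edges this joins them into an edge; on the two halves
    of an edge it cuts that edge. *)
Definition glue x h h' : gluing := (x.1, x.2 * tperm h h')%g.

Lemma closed_setP x S :
  reflect (forall h, (x.1 (x.2 h) \in S) = (x.1 h \in S)) (closed_set x S).
Proof. by apply: (iffP forallP) => c h; apply/eqP/c. Qed.

Lemma involutivebP x : reflect (involutive x.2) (involutiveb x).
Proof. by apply: (iffP forallP) => c h; apply/eqP/c. Qed.

Lemma closed_setC x S : closed_set x S -> closed_set x (~: S).
Proof. by move=> /closed_setP cS; apply/closed_setP => h; rewrite !inE cS. Qed.

Lemma closed_setI x S U : closed_set x S -> closed_set x U -> closed_set x (S :&: U).
Proof.
by move=> /closed_setP cS /closed_setP cU; apply/closed_setP => h; rewrite !inE cS cU.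
Qed.

Lemma component_min x S U :
  component x S -> U \subset S -> closed_set x U -> U = set0 \/ U = S.
Proof.
move=> /and3P[_ _ /forallP/(_ U)/implyP mS] sU cU.
by case/orP: (mS (introT andP (conj sU cU))) => /eqP; [left | right].
Qed.

Lemma componentP x S : closed_set x S -> S != set0 ->
  (forall U, U \subset S -> closed_set x U -> U != set0 -> U = S) -> component x S.
Proof.
move=> cS S0 mS; apply/and3P; split => //; apply/forallP => U.
apply/implyP => /andP[sU cU]; case: (eqVneq U set0) => //= U0.
by apply/eqP/mS.
Qed.

Lemma closed_glue x h h' S : x.2 h = h -> x.2 h' = h' ->
  closed_set (glue x h h') S = closed_set x S && ((x.1 h \in S) == (x.1 h' \in S)).
Proof.
move=> xh xh'; apply/closed_setP/andP => /= [cS | [/closed_setP cS /eqP e] k].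
  have e : (x.1 h \in S) = (x.1 h' \in S).
    by have := cS h; rewrite permM xh tpermL => ->.
  split; last exact/eqP.
  apply/closed_setP => k; rewrite -(cS k) permM.
  by case: tpermP => [-> | -> |].
rewrite permM -(cS k).
by case: tpermP => [-> | -> |].
Qed.

Lemma component_eq x S U v :
  component x S -> component x U -> v \in S -> v \in U -> S = U.
Proof.
move=> cS cU vS vU.
have [/and3P[_ clS _] /and3P[_ clU _]] := (cS, cU).
have clSU := closed_setI clS clU.
have n0 : S :&: U <> set0 by move=> /setP/(_ v); rewrite !inE vS vU.
have [//|eS] := component_min cS (subsetIl S U) clSU.
have [//|eU] := component_min cU (subsetIr S U) clSU.
by rewrite -eS eU.
Qed.

(** Joining h and h' only removes closed sets, those separating their
    endpoints.  So the result is connected exactly if the graph was, or if it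
    consisted of two components with one endpoint each; the set S is then the
    component of h, which makes the sum at most 1. *)
Lemma component_glue x h h' : x.2 h = h -> x.2 h' = h' ->
  component (glue x h h') setT =
  (component x setT + \sum_(S | [&& component x S, component x (~: S),
     x.1 h \in S & x.1 h' \notin S]) 1)%N :> nat.
Proof.
move=> xh xh'; have cg := closed_glue _ xh xh'.
set P := (X in (\sum_(S | X S) _)%N).
have clT y : closed_set y setT by apply/closed_setP => k; rewrite !inE.
have T0 : [set: V] != set0 by apply/set0Pn; exists (x.1 h).
case: (boolP (component x setT)) => [cT|ncT].
  rewrite big_pred0 => [|S]; last first.
    apply/and4P => -[cS _ hS h'S].
    by move: h'S; rewrite (component_eq cS cT hS) inE.
  rewrite addn0; congr nat_of_bool; apply: componentP => // U _.
  rewrite cg => /andP[cU _] U0.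
  by have [UE|//] := component_min cT (subsetT U) cU; rewrite UE eqxx in U0.
rewrite add0n.
case: (boolP (component (glue x h h') setT)) => [cgT|ncgT].
  (* a proper closed set is no longer closed once h and h' are joined *)
  have sep U : closed_set x U -> U != set0 -> U != setT ->
      (x.1 h \in U) = (x.1 h' \notin U).
    move=> cU U0 UT; apply/eqP; apply: contraT => /negP e.
    have cgU : closed_set (glue x h h') U.
      by rewrite cg cU /=; move: e; do 2 case: (_ \in U).
    have [E|E] := component_min cgT (subsetT U) cgU.
      by rewrite E eqxx in U0.
    by rewrite E eqxx in UT.
  (* U contains the endpoint of just one of h and h', so that W or its
     complement in U contains neither endpoint and is trivial *)
  have min U : closed_set x U -> U != set0 -> U != setT -> component x U.
    move=> cU U0 UT; apply: componentP => // W sWU cW W0.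
    have WT : W != setT by apply: contraNneq UT => WE; rewrite -subTset -WE.
    have cD := closed_setI cU (closed_setC cW).
    apply/eqP; rewrite eqEsubset sWU -setD_eq0 setDE; apply: contraT => D0.
    have DT : U :&: ~: W != setT.
      by apply: contraNneq UT => E; rewrite -subTset -E subsetIl.
    have := sep _ cU U0 UT; have := sep _ cW W0 WT; have := sep _ cD D0 DT.
    have /implyP := subsetP sWU (x.1 h); have /implyP := subsetP sWU (x.1 h').
    by rewrite !inE; do 4! case: (_ \in _).
  have C0E (U : {set V}) : (~: U == set0) = (U == setT).
    by rewrite -setCT (inj_eq (@setC_inj _)).
  have CTE (U : {set V}) : (~: U == setT) = (U == set0).
    by rewrite -setC0 (inj_eq (@setC_inj _)).
  have [S /and4P[cS S0 ST hS]] :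
      exists S, [&& closed_set x S, S != set0, S != setT & x.1 h \in S].
    have [S /and3P[cS S0 ST]] : exists S, [&& closed_set x S, S != set0 & S != setT].
      apply/existsP; apply: contraNT ncT => /existsPn nS.
      apply: componentP => // U _ cU U0; apply/eqP.
      by move: (nS U); rewrite cU U0 /= negbK.
    case: (boolP (x.1 h \in S)) => hS; first by exists S; rewrite cS S0 ST.
    by exists (~: S); rewrite closed_setC // !inE hS C0E CTE S0 ST.
  have cC : closed_set x (~: S) by exact: closed_setC.
  rewrite (big_pred1 S) // => U /=; rewrite /P; apply/and4P/eqP => [[cU _ hU _]|->].
    exact: component_eq cU (min _ cS S0 ST) hU hS.
  by rewrite !min ?C0E ?CTE // -sep // hS.
rewrite big_pred0 // => S; apply/and4P => -[cS cC hS h'S].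
move/negP: ncgT; apply; apply: componentP => // U _; rewrite cg => /andP[cU /eqP e] U0.
have [/and3P[_ clS _] /and3P[_ clC _]] := (cS, cC).
have [U1|U1] := component_min cS (subsetIr U S) (closed_setI cU clS);
  have [U2|U2] := component_min cC (subsetIr U (~: S)) (closed_setI cU clC);
  move/setP: U1 => U1; move/setP: U2 => U2.
- case/set0Pn: U0 => v vU; have := U1 v; have := U2 v; rewrite !inE vU.
  by case: (v \in S).
- by have := U1 (x.1 h); have := U2 (x.1 h'); rewrite !inE e hS h'S !andbT => ->.
- by have := U1 (x.1 h); have := U2 (x.1 h'); rewrite !inE e hS h'S !andbT => ->.
- apply/setP => v; have := U1 v; have := U2 v; rewrite !inE.
  by case: (v \in U); case: (v \in S).
Qed.

Lemma glueK h h' : involutive (fun x => glue x h h').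
Proof.
by case=> r s; rewrite /glue /= -mulgA tperm2 mulg1.
Qed.

(** Gluing is a bijection between the involutions in which h and h' form an edge
    and those in which both are external. *)
Lemma graph_on_glue n x h h' : h' != h ->
  graph_on n (glue x h h') && ((glue x h h').2 h == h') =
  [&& involutiveb x, #|legs x| == n.+2, h \in legs x, h' \in legs x &
      component (glue x h h') setT].
Proof.
move=> neq; rewrite /graph_on !inE.
have gh : ((glue x h h').2 h == h') = (x.2 h == h).
  rewrite permM -{2}(tpermL h h') (inj_eq perm_inj) //.
rewrite gh; case: (eqVneq (x.2 h) h) => [xh|_]; rewrite ?andbF ?andbT //=.
have gE k : (glue x h h').2 k = if k == h then h' else if x.2 k == h' then h else x.2 k.
  rewrite permM; case: tpermP => [e|e|/eqP n1 /eqP n2].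
  - by move: e; rewrite -{1}xh => /perm_inj ->; rewrite eqxx.
  - rewrite e eqxx; case: eqP => // kh; by rewrite kh xh in e; rewrite e eqxx in neq.
  - by rewrite (negbTE n2); case: eqP => // kh; rewrite kh xh eqxx in n1.
case: (eqVneq (x.2 h') h') => [xh'|nxh']; last first.
  rewrite !andbF /=; apply/negbTE/negP => /and3P[/involutivebP/(_ h)].
  by rewrite !gE eqxx (negbTE neq) (negbTE nxh') => e _;
    rewrite -(inj_eq (@perm_inj _ x.2)) e xh eqxx in neq.
have fx k : (x.2 k == h) = (k == h) by rewrite -{1}xh (inj_eq perm_inj).
have fx' k : (x.2 k == h') = (k == h') by rewrite -{1}xh' (inj_eq perm_inj).
have -> : involutiveb (glue x h h') = involutiveb x.
  apply: eq_forallb => k; rewrite !gE fx'.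
  case: (eqVneq k h) => [->|kh]; first by rewrite (negbTE neq) xh' !xh eqxx.
  case: (eqVneq k h') => [->|kh']; first by rewrite !xh' !eqxx.
  by rewrite fx (negbTE kh) !fx' (negbTE kh').
have -> : #|legs x| = #|legs (glue x h h')|.+2.
  rewrite (cardsD1 h) (cardsD1 h') !inE xh xh' eqxx neq eqxx /= add1n add1n.
  congr _.+2; apply: eq_card => k; rewrite !inE gE fx'.
  case: (eqVneq k h) => [->|kh] /=; first by rewrite (negbTE neq) andbF.
  case: (eqVneq k h') => [->|kh'] //=; by rewrite eq_sym (negbTE neq).
by rewrite !eqSS ?eqxx /=; case: (involutiveb x); rewrite //= andbC.
Qed.

Section Weight.
Variables (R : comNzRingType) (u : nat -> R).

Definition weight x := \prod_v u #|[set h | x.1 h == v]|.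

(** Double count of graphs with an oriented internal edge (h, h'): the left side
    counts half-edges that are not external, the right side the graphs obtained
    by cutting, with h and h' as two distinguished external half-edges. *)
Lemma cut_edge_sum n :
  \sum_(x | graph_on n x) #|~: legs x|%:R * weight x =
  (n.+2 * n.+1)%:R * \sum_(x | graph_on n.+2 x) weight x +
  \sum_(S : {set V}) \sum_(x | [&& involutiveb x, #|legs x| == n.+2,
                                component x S & component x (~: S)])
    (#|[set h in legs x | x.1 h \in S]| *
     #|[set h in legs x | x.1 h \notin S]|)%:R * weight x.
Proof.
pose base x := involutiveb x && (#|legs x| == n.+2).
transitivity (\sum_h \sum_(h' | h' != h)
    \sum_(x | graph_on n x && (x.2 h == h')) weight x).
  rewrite [RHS](eq_bigr (fun h => \sum_(x | graph_on n x && (h \notin legs x)) weight x)).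
    rewrite (exchange_big_dep (graph_on n)) /=; last by move=> ? ? _ /andP[].
    apply: eq_bigr => x gx; rewrite mulr_natl -sumr_const.
    by apply: eq_bigl => h; rewrite inE gx.
  move=> h _; rewrite (exchange_big_dep (fun x => graph_on n x && (h \notin legs x))) /=.
    apply: eq_bigr => x /andP[gx]; rewrite inE => hx; rewrite (big_pred1 (x.2 h)) // => h' /=.
    rewrite gx eq_sym [h' == _]eq_sym.
    by case: (eqVneq (x.2 h) h') hx => [->|]; rewrite ?andbF // eq_sym => ->.
  by move=> h' x nh /andP[-> /eqP e]; rewrite inE e.
transitivity (\sum_h \sum_(h' | h' != h)
    \sum_(x | base x && [&& h \in legs x, h' \in legs x & component (glue x h h') setT])
       weight x).
  apply: eq_bigr => h _; apply: eq_bigr => h' neq.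
  rewrite (reindex_inj (can_inj (glueK h h'))) /=.
  by apply: eq_big => x; rewrite ?graph_on_glue // /base -andbA.
transitivity (\sum_(x | base x) (\sum_(h in legs x) \sum_(h' in legs x | h' != h)
    component (glue x h h') setT)%:R * weight x).
  under [RHS]eq_bigr do rewrite natr_sum mulr_suml.
  rewrite [RHS](exchange_big_dep predT) //=; apply: eq_bigr => h _.
  under [RHS]eq_bigr do rewrite natr_sum mulr_suml.
  rewrite [RHS](exchange_big_dep (fun h' => h' != h)) /=; last by move=> ? ? _ /andP[].
  apply: eq_bigr => h' neq.
  rewrite [LHS](eq_bigl (fun x => (base x && (h \in legs x) && (h' \in legs x)) &&
    component (glue x h h') setT)).
    rewrite big_mkcondr; apply: eq_big => x; first by rewrite neq andbT.
    by rewrite mulr_natl; case: (component _ _).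
  by move=> x; rewrite -!andbA.
rewrite [in RHS]mulr_sumr.
rewrite (exchange_big_dep base) /=; last by move=> S x _ /and4P[ix lx _ _]; rewrite /base ix.
rewrite [X in _ = X + _](eq_bigl (fun x => base x && component x setT)); last first.
  by move=> x; rewrite /graph_on /base; case: (involutiveb x); rewrite //= andbC.
rewrite [X in _ = X + _]big_mkcondr -big_split /=; apply: eq_bigr => x /andP[ix /eqP lx].
rewrite [RHS](_ : _ = ((n.+2 * n.+1 * component x setT) +
  \sum_(S : {set V} | component x S && component x (~: S))
    (#|[set h in legs x | x.1 h \in S]| *
     #|[set h in legs x | x.1 h \notin S]|))%:R * weight x).
  congr (_%:R * _).
  transitivity (\sum_(h in legs x) \sum_(h' in legs x | h' != h)
     (component x setT + \sum_(S : {set V} | component x S && component x (~: S))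
       ((x.1 h \in S) && (x.1 h' \notin S))))%N.
    apply: eq_bigr => h; rewrite inE => /eqP xh; apply: eq_bigr => h'.
    rewrite inE => /andP[/eqP xh' _]; rewrite component_glue //; congr addn.
    rewrite [RHS](eq_bigr (fun S => if (x.1 h \in S) && (x.1 h' \notin S) then 1 else 0)%N).
      by rewrite -big_mkcondr; apply: eq_bigl => S; rewrite -andbA.
    by move=> S _; case: ifP.
  under eq_bigr do rewrite big_split /=; rewrite big_split /=; congr addn.
    transitivity (\sum_(h in legs x) n.+1 * component x setT)%N.
      apply: eq_bigr => h hx; rewrite sum_nat_const; congr muln.
      rewrite -[RHS]/(n.+2.-1) -lx (cardsD1 h) hx add1n /=.
      by apply: eq_card => k; rewrite [LHS]unfold_in !inE andbC.
    by rewrite sum_nat_const lx mulnA.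
  under eq_bigr do rewrite exchange_big /=; rewrite exchange_big /=.
  apply: eq_bigr => S _.
  transitivity (\sum_(h in legs x) \sum_(h' in legs x) (x.1 h \in S) * (x.1 h' \notin S))%N.
    apply: eq_bigr => h hx; rewrite [RHS](bigD1 h) //= mulnb andbN add0n.
    by apply: eq_bigr => h' _; rewrite mulnb.
  rewrite -big_distrlr /= -!sum1_card; congr muln.
    by rewrite -big_mkcondr; apply: eq_bigl => h; rewrite inE.
  by rewrite -big_mkcondr; apply: eq_bigl => h; rewrite inE.
rewrite natrD mulrDl; congr (_ + _).
  by case: (component _ _); rewrite ?muln1 // muln0 mul0r.
rewrite natr_sum mulr_suml; apply: eq_bigl => S.
by rewrite ix lx eqxx.
Qed.

End Weight.
End Gluings.

(** * Splitting a graph with two components *)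

Section Restriction.
Variables (V1 H1 V H : finType) (e : V1 -> V) (k : H1 -> H).
Implicit Types (x : gluing V H) (y : gluing V1 H1).

(** The embeddings e of vertices and k of half-edges make y a subgraph of x; it
    is a union of components of x when the half-edges of x attached to the
    image of e are exactly the image of k. *)
Definition restricts x y :=
  [forall h, x.1 (k h) == e (y.1 h)] && [forall h, x.2 (k h) == k (y.2 h)].

Hypotheses (e_inj : injective e) (k_inj : injective k).

Lemma restricts_uniq x y y' : restricts x y -> restricts x y' -> y = y'.
Proof.
case: y => [r s]; case: y' => [r' s'].
move=> /andP[/= /forallP a /forallP b] /andP[/= /forallP a' /forallP b'].
congr pair; first by apply/ffunP => h; apply: e_inj; rewrite -(eqP (a h)) (eqP (a' h)).
by apply/perm.permP => h; apply: k_inj; rewrite -(eqP (b h)) (eqP (b' h)).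
Qed.

Lemma restricts_exists x : (forall h, (x.1 h \in e @: setT) = (h \in k @: setT)) ->
  closed_set x (e @: setT) -> exists y, restricts x y.
Proof.
move=> cov /closed_setP cS.
have [r rP] : exists r : H1 -> V1, forall h, x.1 (k h) = e (r h).
  apply: (@fin_all_exists _ _ (fun h v => x.1 (k h) = e v)) => h.
  have : x.1 (k h) \in e @: setT by rewrite cov imset_f.
  by case/imsetP => v _ ->; exists v.
have [s sP] : exists s : H1 -> H1, forall h, x.2 (k h) = k (s h).
  apply: (@fin_all_exists _ _ (fun h h' => x.2 (k h) = k h')) => h.
  have : x.2 (k h) \in k @: setT by rewrite -cov cS cov imset_f.
  by case/imsetP => v _ ->; exists v.
have s_inj : injective s.
  by move=> h h' E; apply: k_inj; apply: (@perm_inj _ x.2); rewrite !sP E.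
exists ([ffun h => r h], perm s_inj).
by apply/andP; split; apply/forallP => h /=; rewrite ?ffunE ?permE ?rP ?sP.
Qed.

Section Fixed.
Variables (x : gluing V H) (y : gluing V1 H1).
Hypotheses (cov : forall h, (x.1 h \in e @: setT) = (h \in k @: setT))
  (rxy : restricts x y).

Let rE h : x.1 (k h) = e (y.1 h).
Proof. by have /andP[/forallP/(_ h)/eqP] := rxy. Qed.

Let sE h : x.2 (k h) = k (y.2 h).
Proof. by have /andP[_ /forallP/(_ h)/eqP] := rxy. Qed.

Let kT h : (x.2 h \in k @: setT) = (h \in k @: setT).
Proof.
apply/imsetP/imsetP => [[h1 _ E]|[h1 _ ->]]; last by exists (y.2 h1); rewrite ?sE.
exists ((y.2^-1)%g h1) => //; apply: (@perm_inj _ x.2).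
by rewrite sE permKV.
Qed.

Lemma closed_set_codom : closed_set x (e @: setT).
Proof. by apply/closed_setP => h; rewrite !cov kT. Qed.

Lemma closed_set_imset (U : {set V1}) : closed_set x (e @: U) = closed_set y U.
Proof.
apply/closed_setP/closed_setP => c h.
  by have := c (k h); rewrite sE !rE !(mem_imset _ _ e_inj).
have sub v : v \in e @: U -> v \in e @: setT.
  by apply/subsetP/imsetS/subsetT.
case: (boolP (h \in k @: setT)) => [/imsetP[h1 _ ->]|nh].
  by rewrite sE !rE !(mem_imset _ _ e_inj) c.
transitivity false; last symmetry; apply/negbTE; apply: contra nh => /sub.
  by rewrite cov kT.
by rewrite cov.
Qed.

Lemma component_codom : component x (e @: setT) = component y setT.
Proof.
have e0 (U : {set V1}) : (e @: U == set0) = (U == set0).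
  apply/eqP/eqP => [E|->]; last by rewrite imset0.
  by apply/setP => v; rewrite -(mem_imset _ _ e_inj) E !inE.
apply/idP/idP => c.
  have /and3P[n0 _ _] := c; rewrite e0 in n0.
  apply: componentP => //; first by apply/closed_setP => h; rewrite !inE.
  move=> U _ cU; rewrite -e0 => U0.
  rewrite -closed_set_imset in cU.
  have [E|E] := component_min c (imsetS _ (subsetT U)) cU; first by rewrite E eqxx in U0.
  exact: (imset_inj e_inj).
have /and3P[n0 _ _] := c.
apply: componentP; rewrite ?e0 ?closed_set_codom // => U sU cU U0.
have UE : U = e @: (e @^-1: U).
  apply/setP => v; apply/idP/imsetP => [vU|[w]]; last by rewrite inE => wU ->.
  have /imsetP[w _ E] := subsetP sU _ vU.
  by exists w => //; rewrite inE -E.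
rewrite UE closed_set_imset in cU; rewrite UE e0 in U0.
have [E|E] := component_min c (subsetT _) cU; first by rewrite E eqxx in U0.
by rewrite UE E.
Qed.

Lemma card_fiber v : #|[set h | x.1 h == e v]| = #|[set h | y.1 h == v]|.
Proof.
rewrite -(card_imset _ k_inj); apply: eq_card => h; rewrite !inE.
apply/eqP/imsetP => [E|[h1]]; last by rewrite inE => /eqP <- ->.
have /imsetP[h1 _ hE] : h \in k @: setT by rewrite -cov E imset_f.
by exists h1; rewrite // inE -(inj_eq e_inj) -rE -hE E.
Qed.

Lemma card_legs : #|[set h in legs x | x.1 h \in e @: setT]| = #|legs y|.
Proof.
rewrite -(card_imset _ k_inj); apply: eq_card => h; rewrite !inE cov.
apply/andP/imsetP => [[/eqP xh /imsetP[h1 _ E]]|[h1]].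
  by exists h1; rewrite // inE -(inj_eq k_inj) -sE -E xh.
by rewrite inE => /eqP E ->; rewrite sE E eqxx imset_f.
Qed.

Lemma restricts_involutive : involutive x.2 -> involutive y.2.
Proof. by move=> xK h; apply: k_inj; rewrite -!sE xK. Qed.

Lemma prod_codom (R : comNzRingType) (u : nat -> R) :
  \prod_(v in e @: setT) u #|[set h | x.1 h == v]| = weight u y.
Proof.
rewrite big_imset /=; last by move=> ? ? _ _; apply: e_inj.
by apply: eq_big => v; rewrite ?inE // card_fiber.
Qed.

End Fixed.
End Restriction.

Section Decomposition.
Variables (V H : finType) (R : comNzRingType) (u : nat -> R).

(** Sum over connected labelled graphs with a vertices, b half-edges and n
    external edges, where u n is the weight of a vertex of valence n. *)
Definition graph_sum (a b n : nat) : R :=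
  \sum_(y : gluing 'I_a 'I_b | graph_on n y) weight u y.

Lemma imset_enum_val (T : finType) (A : {set T}) : (@enum_val _ (mem A)) @: setT = A.
Proof.
apply/setP => v; apply/imsetP/idP => [[i _ ->]|vA]; first exact: enum_valP.
by exists (enum_rank_in vA v); rewrite ?enum_rankK_in.
Qed.

Lemma card_split (T : finType) (A : {set T}) (P : pred T) :
  #|[set h in A | P h]| + #|[set h in A | ~~ P h]| = #|A|.
Proof.
rewrite -[RHS](cardsID [set h | P h]); congr addn; apply: eq_card => h.
  by rewrite !inE.
by rewrite !inE andbC.
Qed.

Section Join.
Variables (V1 H1 V2 H2 : finType).
Variables (e1 : V1 -> V) (k1 : H1 -> H) (e2 : V2 -> V) (k2 : H2 -> H).
Hypotheses (k1_inj : injective k1) (k2_inj : injective k2).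
Hypothesis k2E : k2 @: setT = ~: (k1 @: setT).

Let k_cover h : (exists h1, h = k1 h1) \/ (exists h2, h = k2 h2).
Proof.
case: (boolP (h \in k1 @: setT)) => [/imsetP[h1 _ ->]|]; first by left; exists h1.
by rewrite -in_setC -k2E => /imsetP[h2 _ ->]; right; exists h2.
Qed.

Let k_disjoint h1 h2 : k1 h1 <> k2 h2.
Proof.
by move=> E; have := imset_f k2 (in_setT h2); rewrite k2E inE -E imset_f.
Qed.

Let joinf (A : Type) (f1 : H1 -> A) (f2 : H2 -> A) :
  exists2 f : H -> A, (forall h, f (k1 h) = f1 h) & (forall h, f (k2 h) = f2 h).
Proof.
have [f fP] : exists f : forall h : H, A, forall h, (forall h1, h = k1 h1 -> f h = f1 h1)
    /\ (forall h2, h = k2 h2 -> f h = f2 h2).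
  apply: (@fin_all_exists _ (fun=> A) (fun h a => (forall h1, h = k1 h1 -> a = f1 h1)
    /\ (forall h2, h = k2 h2 -> a = f2 h2))) => h.
  case: (k_cover h) => -[h' ->].
    exists (f1 h'); split=> [h1 /k1_inj -> //|h2 /k_disjoint //].
  by exists (f2 h'); split=> [h1 /esym /k_disjoint //|h2 /k2_inj -> //].
exists f => h; first by have [p1 _] := fP (k1 h); exact: p1.
by have [_ p2] := fP (k2 h); exact: p2.
Qed.

Lemma restricts_join (y1 : gluing V1 H1) (y2 : gluing V2 H2) :
  exists2 x, restricts e1 k1 x y1 & restricts e2 k2 x y2.
Proof.
have [r r1 r2] := joinf (e1 \o y1.1) (e2 \o y2.1).
have [s s1 s2] := joinf (k1 \o y1.2) (k2 \o y2.2).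
have s_inj : injective s.
  move=> h h'; case: (k_cover h) => -[g ->]; case: (k_cover h') => -[g' ->].
  - by rewrite !s1 /= => /k1_inj/perm_inj ->.
  - by rewrite s1 s2 => /k_disjoint.
  - by rewrite s1 s2 => /esym/k_disjoint.
  - by rewrite !s2 /= => /k2_inj/perm_inj ->.
exists ([ffun h => r h], perm s_inj);
  apply/andP; split; apply/forallP => h /=; rewrite ?ffunE ?permE.
- by rewrite r1.
- by rewrite s1.
- by rewrite r2.
- by rewrite s2.
Qed.

Lemma restricts_join_uniq (y1 : gluing V1 H1) (y2 : gluing V2 H2) (x x' : gluing V H) :
  restricts e1 k1 x y1 -> restricts e2 k2 x y2 ->
  restricts e1 k1 x' y1 -> restricts e2 k2 x' y2 -> x = x'.
Proof.
case: x x' => [r s] [r' s'].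
move=> /andP[/forallP a1 /forallP b1] /andP[/forallP a2 /forallP b2].
move=> /andP[/forallP c1 /forallP d1] /andP[/forallP c2 /forallP d2].
congr pair; [apply/ffunP => h | apply/perm.permP => h]; case: (k_cover h) => -[g ->].
- by rewrite (eqP (a1 _)) (eqP (c1 _)).
- by rewrite (eqP (a2 _)) (eqP (c2 _)).
- by rewrite (eqP (b1 _)) (eqP (d1 _)).
- by rewrite (eqP (b2 _)) (eqP (d2 _)).
Qed.

Lemma restricts_join_involutive (y1 : gluing V1 H1) (y2 : gluing V2 H2) (x : gluing V H) :
  restricts e1 k1 x y1 -> restricts e2 k2 x y2 ->
  involutiveb x = involutiveb y1 && involutiveb y2.
Proof.
move=> r1 r2; apply/involutivebP/andP => [xK|[/involutivebP yK1 /involutivebP yK2] h].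
  by split; apply/involutivebP;
    [apply: restricts_involutive k1_inj _ _ r1 xK
    |apply: restricts_involutive k2_inj _ _ r2 xK].
have /andP[_ /forallP b1] := r1; have /andP[_ /forallP b2] := r2.
case: (k_cover h) => -[g ->].
  by rewrite (eqP (b1 _)) (eqP (b1 _)) yK1.
by rewrite (eqP (b2 _)) (eqP (b2 _)) yK2.
Qed.

End Join.

(** With the vertex sets S, ~: S and the half-edge sets T, ~: T of the two
    components fixed, a graph is a pair of connected graphs; these are moved to
    the standard types by enumerating the four sets.  The factor counts the
    choices of one external half-edge in each component. *)
Lemma sum_two_components m (S : {set V}) (T : {set H}) :
  \sum_(x : gluing V H | [&& involutiveb x, #|legs x| == m, component x S & component x (~: S)]
     && ([set h | x.1 h \in S] == T))
    (#|[set h in legs x | x.1 h \in S]| *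
     #|[set h in legs x | x.1 h \notin S]|)%:R * weight u x =
  \sum_(j < m.+1) (j * (m - j))%:R * (graph_sum #|S| #|T| j * graph_sum #|~: S| #|~: T| (m - j)).
Proof.
pose e1 := @enum_val _ (mem S); pose e2 := @enum_val _ (mem (~: S)).
pose k1 := @enum_val _ (mem T); pose k2 := @enum_val _ (mem (~: T)).
pose r (x : gluing V H) (y : gluing 'I_#|S| 'I_#|T| * gluing 'I_#|~: S| 'I_#|~: T|) :=
  [&& [set h | x.1 h \in S] == T, restricts e1 k1 x y.1 & restricts e2 k2 x y.2].
pose Q (y : gluing 'I_#|S| 'I_#|T| * gluing 'I_#|~: S| 'I_#|~: T|) :=
  [&& involutiveb y.1, involutiveb y.2, component y.1 setT, component y.2 setT
    & (#|legs y.1| + #|legs y.2| == m)%N].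
have e1E : e1 @: setT = S := imset_enum_val S.
have e2E : e2 @: setT = ~: S := imset_enum_val (~: S).
have k1E : k1 @: setT = T := imset_enum_val T.
have k2E : k2 @: setT = ~: (k1 @: setT) by rewrite k1E; exact: imset_enum_val.
have [e1_inj e2_inj] : injective e1 /\ injective e2 by split; exact: enum_val_inj.
have [k1_inj k2_inj] : injective k1 /\ injective k2 by split; exact: enum_val_inj.
have cov1 (x : gluing V H) : [set h | x.1 h \in S] == T ->
    forall h, (x.1 h \in e1 @: setT) = (h \in k1 @: setT).
  by move=> /eqP xT h; rewrite e1E k1E -xT inE.
have cov2 (x : gluing V H) : [set h | x.1 h \in S] == T ->
    forall h, (x.1 h \in e2 @: setT) = (h \in k2 @: setT).
  by move=> /eqP xT h; rewrite e2E k2E k1E -xT !inE.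
have legs1 x y : r x y -> #|[set h in legs x | x.1 h \in S]| = #|legs y.1|.
  by case/and3P => xT r1 r2; rewrite -(card_legs k1_inj (cov1 _ xT) r1) e1E.
have legs2 x y : r x y -> #|[set h in legs x | x.1 h \notin S]| = #|legs y.2|.
  case/and3P => xT r1 r2; rewrite -(card_legs k2_inj (cov2 _ xT) r2) e2E.
  by apply: eq_card => h; rewrite !inE.
transitivity (\sum_(y | Q y) (#|legs y.1| * #|legs y.2|)%:R * (weight u y.1 * weight u y.2)).
  apply: (sum_correspondence (r := r)).
  - move=> x /andP[/and4P[ix lx cS cC] xT].
    have [/and3P[_ clS _] /and3P[_ clC _]] := (cS, cC).
    have [y1 r1] : exists y1, restricts e1 k1 x y1.
      by apply: (restricts_exists k1_inj (cov1 _ xT)); rewrite e1E.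
    have [y2 r2] : exists y2, restricts e2 k2 x y2.
      by apply: (restricts_exists k2_inj (cov2 _ xT)); rewrite e2E.
    by exists (y1, y2); rewrite /r xT r1 r2.
  - move=> [y1 y2] _.
    have [x r1 r2] := restricts_join e1 e2 k1_inj k2_inj k2E y1 y2.
    exists x; rewrite /r /= r1 r2 !andbT eqEsubset; apply/andP; split; apply/subsetP => h.
      rewrite inE; apply: contraLR => hT.
      have : h \in k2 @: setT by rewrite k2E k1E inE.
      case/imsetP => h2 _ ->; case/andP: r2 => /forallP/(_ h2)/eqP -> _.
      by have : e2 (y2.1 h2) \in ~: S := enum_valP _; rewrite inE.
    rewrite -k1E => /imsetP[h1 _ ->]; case/andP: r1 => /forallP/(_ h1)/eqP E _.
    by rewrite inE E; exact: enum_valP.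
  - move=> x y rxy; have /and3P[xT r1 r2] := rxy; rewrite xT andbT /Q.
    rewrite (restricts_join_involutive k1_inj k2_inj k2E r1 r2) -andbA; do 2 congr andb.
    rewrite -(card_split (legs x) (fun h => x.1 h \in S)) (legs1 _ _ rxy) (legs2 _ _ rxy).
    rewrite -(component_codom e1_inj (cov1 _ xT) r1) -(component_codom e2_inj (cov2 _ xT) r2).
    by rewrite e1E e2E andbC -andbA.
  - move=> x [y1 y2] [y1' y2'] /and3P[_ /= a1 a2] /and3P[_ /= b1 b2].
    by rewrite (restricts_uniq e1_inj k1_inj a1 b1) (restricts_uniq e2_inj k2_inj a2 b2).
  - move=> x x' y /and3P[_ a1 a2] /and3P[_ b1 b2].
    exact: restricts_join_uniq k2E _ _ _ _ a1 a2 b1 b2.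
  - move=> x y _ rxy; have /and3P[xT r1 r2] := rxy.
    rewrite (legs1 _ _ rxy) (legs2 _ _ rxy); congr (_ * _).
    rewrite -(prod_codom e1_inj k1_inj (cov1 _ xT) r1) -(prod_codom e2_inj k2_inj (cov2 _ xT) r2).
    rewrite /weight (bigID (mem S)) /= e1E e2E; congr (_ * _).
    by apply: eq_bigl => v; rewrite inE.
rewrite /graph_sum.
under [RHS]eq_bigr do rewrite big_distrlr pair_big /= mulr_sumr.
rewrite (exchange_big_dep Q) /=; last first.
  move=> j y _ /andP[/and3P[a b /eqP c] /and3P[a' b' /eqP c']].
  by rewrite /Q a a' b b' c c' subnKC ?eqxx // -ltnS.
apply: eq_bigr => y /and5P[a b c d /eqP e].
have lt1 : (#|legs y.1| < m.+1)%N by rewrite ltnS -e leq_addr.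
rewrite (big_pred1 (Ordinal lt1)) /= => [|j].
  by rewrite -e addKn.
rewrite /graph_on a b c d /= -val_eqE /=; apply/andP/eqP => [[/eqP -> //]|->].
by rewrite -e addKn !eqxx.
Qed.
End Decomposition.

(** * Recursion for sums over labelled graphs *)

Lemma sum_sets_card (R : pzSemiRingType) (T : finType) (F : nat -> nat -> R) :
  \sum_(S : {set T}) F #|S| #|~: S| =
  \sum_(a < #|T|.+1) 'C(#|T|, a)%:R * F a (#|T| - a)%N.
Proof.
have lt (S : {set T}) : (#|S| < #|T|.+1)%N by rewrite ltnS max_card.
rewrite (partition_big (fun S => Ordinal (lt S)) predT) //=; apply: eq_bigr => a _.
rewrite -card_draws mulr_natl -sumr_const; apply: eq_big => S; rewrite ?inE //.
by move=> /eqP <- /=; rewrite [#|~: S|]cardsCs setCK.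
Qed.

Section Recursion.
Variables (R : comNzRingType) (u : nat -> R).

(** Only the sizes of the two components matter, so the sums over the sets S and
    T become sums over sizes with binomial coefficients. *)
Lemma graph_sum_rec v b n :
  (b - n)%:R * graph_sum u v b n =
  (n.+2 * n.+1)%:R * graph_sum u v b n.+2 +
  \sum_(a < v.+1) 'C(v, a)%:R * \sum_(c < b.+1) 'C(b, c)%:R *
    \sum_(j < n.+3) (j * (n.+2 - j))%:R *
      (graph_sum u a c j * graph_sum u (v - a) (b - c) (n.+2 - j)).
Proof.
transitivity (\sum_(x : gluing 'I_v 'I_b | graph_on n x) #|~: legs x|%:R * weight u x).
  rewrite mulr_sumr; apply: eq_bigr => x /and3P[_ _ /eqP <-].
  by rewrite [#|~: _|]cardsCs setCK card_ord.
rewrite cut_edge_sum; congr (_ + _).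
under eq_bigr => S _.
  rewrite (partition_big (fun x : gluing 'I_v 'I_b => [set h | x.1 h \in S]) predT) //=.
  under eq_bigr => T _ do rewrite sum_two_components.
  rewrite (sum_sets_card _ (fun c c' => \sum_(j < n.+3) (j * (n.+2 - j))%:R *
    (graph_sum u #|S| c j * graph_sum u #|~: S| c' (n.+2 - j)))) card_ord.
over.
by rewrite (sum_sets_card _ (fun a a' => \sum_(c < b.+1) 'C(b, c)%:R *
  \sum_(j < n.+3) (j * (n.+2 - j))%:R *
    (graph_sum u a c j * graph_sum u a' (b - c) (n.+2 - j)))) card_ord.
Qed.

(** Without internal edges every set of vertices is closed, so that a connected
    graph has a single vertex. *)
Lemma graph_sum_edgeless v b : graph_sum u v b b = if v == 1%N then u b else 0.
Proof.
have idx (x : gluing 'I_v 'I_b) : #|legs x| = b -> x.2 = 1%g.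
  move=> lx; have LT : legs x = setT.
    by apply/eqP; rewrite eqEcard subsetT cardsT card_ord lx leqnn.
  by apply/perm.permP => h; rewrite perm1; apply/eqP; have := in_setT h; rewrite -LT inE.
case: eqP idx => [->|v1] idx; last first.
  apply: big_pred0 => x; apply/and3P => -[_ cT /eqP/idx x1].
  have /set0Pn[w _] : [set: 'I_v] != set0 by case/and3P: cT.
  have c1 : closed_set x [set w] by apply/closed_setP => h; rewrite x1 perm1.
  have [E|E] := component_min cT (subsetT _) c1.
    by have := set11 w; rewrite E inE.
  by apply: v1; rewrite -[LHS]card_ord -cardsT -E cards1.
rewrite /graph_sum.
rewrite (big_pred1 ([ffun=> ord0], 1%g)) => [|x /=].
  rewrite /weight big_ord1; congr u.
  transitivity #|[set: 'I_b]|; last by rewrite cardsT card_ord.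
  by apply: eq_card => h; rewrite !inE ffunE.
apply/and3P/eqP => [[_ _ /eqP lx]|->].
  move: (idx _ lx); case: x {lx} => r s /= ->; congr pair.
  by apply/ffunP => h; rewrite ffunE; exact: ord1.
split.
- by apply/involutivebP => h; rewrite !perm1.
- apply: componentP.
  + by apply/closed_setP => h; rewrite !inE.
  + by apply/set0Pn; exists ord0; rewrite inE.
  + move=> U _ _ /set0Pn[w wU]; apply/setP => w'.
    by rewrite inE (ord1 w') -(ord1 w).
- rewrite -[X in _ == X]card_ord -cardsT; apply/eqP/eq_card => h.
  by rewrite !inE perm1 eqxx.
Qed.

(** The internal edges partition the half-edges that are not external into
    pairs. *)
Lemma card_nonlegs (V H : finType) (x : gluing V H) : involutiveb x ->
  #|~: legs x| = (#|[set [set h; x.2 h] | h in ~: legs x]| * 2)%N.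
Proof.
move=> /involutivebP xK; apply: card_uniform_partition => [A /imsetP[h]|].
  by rewrite !inE => xh ->; rewrite cards2 eq_sym xh.
apply/and3P; split.
- apply/eqP/setP => h; apply/bigcupP/idP => [[A /imsetP[h' xh' ->]]|xh].
    by move: xh'; rewrite !inE => xh' /orP[]/eqP -> //; rewrite xK eq_sym.
  by exists [set h; x.2 h]; [apply: imset_f | rewrite !inE eqxx].
- apply/trivIsetP => A B /imsetP[h _ ->] /imsetP[h' _ ->] neq.
  have mem k g : k \in [set g; x.2 g] -> [set g; x.2 g] = [set k; x.2 k].
    by rewrite !inE => /orP[]/eqP -> //; rewrite xK setUC.
  rewrite -setI_eq0; apply: contraNT neq => /set0Pn[k /setIP[kh kh']].
  by rewrite (mem _ _ kh) (mem _ _ kh').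
- by apply/imsetP => -[h _ /setP/(_ h)]; rewrite !inE eqxx.
Qed.

Lemma graph_sum_neq0 v b n : graph_sum u v b n != 0 ->
  exists k, b = (k.*2 + n)%N.
Proof.
case: (pickP (fun x : gluing 'I_v 'I_b => graph_on n x)) => [x /and3P[ix _ /eqP <-] _|P0].
  exists #|[set [set h; x.2 h] | h in ~: legs x]|.
  by rewrite -muln2 -card_nonlegs // addnC cardsC card_ord.
by rewrite /graph_sum big_pred0 ?eqxx.
Qed.

End Recursion.

(** The product of two polynomials evaluated at 1, computed in two ways. *)
Lemma sum_triangle (R : comNzRingType) (f g : nat -> R) i j :
  (forall a, (i < a)%N -> f a = 0) -> (forall a, (j < a)%N -> g a = 0) ->
  \sum_(v < (i + j).+1) \sum_(a < v.+1) f a * g (v - a)%N =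
  (\sum_(a < i.+1) f a) * (\sum_(a < j.+1) g a).
Proof.
move=> f0 g0; pose p := \poly_(a < i.+1) f a; pose q := \poly_(a < j.+1) g a.
have p1 : p.[1] = \sum_(a < i.+1) f a.
  by rewrite horner_poly; apply: eq_bigr => a _; rewrite expr1n mulr1.
have q1 : q.[1] = \sum_(a < j.+1) g a.
  by rewrite horner_poly; apply: eq_bigr => a _; rewrite expr1n mulr1.
have pE a : p`_a = f a by rewrite coef_poly; case: ltnP => // /f0.
have qE a : q`_a = g a by rewrite coef_poly; case: ltnP => // /g0.
rewrite -p1 -q1 -hornerM (@horner_coef_wide _ (i + j).+1).
  apply: eq_bigr => v _; rewrite expr1n mulr1 coefM.
  by apply: eq_bigr => a _; rewrite pE qE.
apply: leq_trans (size_polyMleq _ _) _.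
have := size_poly i.+1 f; have := size_poly j.+1 g; rewrite -/p -/q => hq hp.
by have := leq_add hp hq; rewrite addSn addnS; case: (_ + _)%N.
Qed.

(** The number of half-edges is twice the number of edges plus the number of
    external edges, so a sum over it is a sum over the number of edges. *)
Lemma sum_dilate (R : nmodType) (G : nat -> R) j E N :
  (forall c, G c != 0 -> (c < N)%N -> exists2 k, (k <= E)%N & c = (k.*2 + j)%N) ->
  (E.*2 + j < N)%N ->
  \sum_(c < N) G c = \sum_(k < E.+1) G (k.*2 + j)%N.
Proof.
move=> GP ltN.
rewrite (bigID (fun c : 'I_N => G c != 0)) /= [X in _ + X]big1 ?addr0; last first.
  by move=> c; rewrite negbK => /eqP.
rewrite [RHS](bigID (fun k : 'I_E.+1 => G (k.*2 + j)%N != 0)) /=.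
rewrite [X in _ = _ + X]big1 ?addr0; last by move=> c; rewrite negbK => /eqP.
apply: (sum_correspondence (r := fun (c : 'I_N) (k : 'I_E.+1) => c == k.*2 + j :> nat)).
- move=> c /GP/(_ (ltn_ord c)) [k kE ->].
  by exists (Ordinal (kE : (k < E.+1)%N)) => /=.
- move=> k _; have lt : (k.*2 + j < N)%N.
    by apply: leq_ltn_trans ltN; rewrite leq_add2r leq_double -ltnS.
  by exists (Ordinal lt) => /=.
- by move=> c k /eqP ->.
- move=> c k k' /eqP -> /eqP /addIn/double_inj e; exact: val_inj.
- move=> c c' k /eqP e /eqP e'; by apply: val_inj; rewrite /= e e'.
- by move=> c k _ /eqP ->.
Qed.

Section Counts.
Variable u : nat -> {poly rat}.
Hypothesis u0 : forall k, (u k)`_0 = 0.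

(** The variable of u records the degree 2g - 2 + n of each vertex, so d is the
    degree of the graph.  Dividing by the factorials turns sums over labelled
    graphs into sums over isomorphism classes weighted by 1 / |Aut|. *)
Definition graph_coef (v b n d : nat) : rat :=
  (graph_sum u v b n)`_d / (v`! * b`!)%:R.

(** Every vertex has positive degree, hence at most d vertices occur. *)
Definition graph_count (d n E : nat) : rat :=
  \sum_(v < d.+1) graph_coef v (E.*2 + n) n d.

Lemma coef_prod_small (I : finType) (p : I -> {poly rat}) d :
  (forall i, (p i)`_0 = 0) -> (d < #|I|)%N -> (\prod_i p i)`_d = 0.
Proof.
move=> p0 ltd; have [q qE] : exists q : I -> {poly rat}, forall i, p i = q i * 'X.
  apply: (@fin_all_exists _ _ (fun i q => p i = q * 'X)) => i.
  have : root (p i) 0 by rewrite /root horner_coef0 p0.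
  by case/factor_theorem => q; rewrite subr0; exists q.
rewrite (eq_bigr _ (fun i _ => qE i)) big_split /= prodr_const coefMXn.
by rewrite ltd.
Qed.

Lemma graph_coef_small v b n d : (d < v)%N -> graph_coef v b n d = 0.
Proof.
move=> ltd; rewrite /graph_coef coef_sum big1 ?mul0r // => x _.
by apply: coef_prod_small; rewrite ?card_ord.
Qed.

Lemma graph_coef_neq0 v b n d : graph_coef v b n d != 0 -> exists k, b = (k.*2 + n)%N.
Proof.
move=> c0; apply: (@graph_sum_neq0 _ u v); apply: contraNneq c0 => E.
by rewrite /graph_coef E coef0 mul0r.
Qed.

Lemma graph_coef_rec v b n d :
  (b - n)%:R * graph_coef v b n d =
  (n.+2 * n.+1)%:R * graph_coef v b n.+2 d +
  \sum_(a < v.+1) \sum_(c < b.+1) \sum_(j < n.+3) \sum_(i < d.+1)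
    (j * (n.+2 - j))%:R *
      (graph_coef a c j i * graph_coef (v - a) (b - c) (n.+2 - j) (d - i)).
Proof.
have cM (m : nat) (p : {poly rat}) k : (m%:R * p)`_k = m%:R * p`_k.
  by rewrite mulr_natl coefMn mulr_natl.
rewrite {1 2}/graph_coef !mulrA -!cM graph_sum_rec coefD mulrDl; congr (_ + _).
have f0 m : (m`!)%:R != 0 :> rat by rewrite pnatr_eq0 -lt0n fact_gt0.
rewrite coef_sum mulr_suml; apply: eq_bigr => a _.
rewrite cM coef_sum mulr_sumr mulr_suml; apply: eq_bigr => c _.
rewrite cM coef_sum !mulr_sumr mulr_suml; apply: eq_bigr => j _.
rewrite cM coefM !mulr_sumr mulr_suml; apply: eq_bigr => i _.
rewrite /graph_coef.
have le_av : (a <= v)%N by rewrite -ltnS.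
have le_cb : (c <= b)%N by rewrite -ltnS.
rewrite -(bin_fact le_av) -(bin_fact le_cb) !natrM.
set x := (_)`_i; set y := (_)`_(d - i).
have bn0 m k : (k <= m)%N -> 'C(m, k)%:R != 0 :> rat by rewrite pnatr_eq0 -lt0n bin_gt0.
have := (bn0 _ _ le_av, bn0 _ _ le_cb, f0 a, f0 (v - a)%N, f0 c, f0 (b - c)%N).
case=> -[] [] [] [] h1 h2 h3 h4 h5 h6.
by field; rewrite ?h1 ?h2 ?h3 ?h4 ?h5 ?h6.
Qed.

Lemma graph_count0 d n : graph_count d n 0 = if d == 0%N then 0 else (u n)`_d / (n`!)%:R.
Proof.
rewrite /graph_count double0 add0n /graph_coef.
case: d => [|d].
  by rewrite big_ord1 graph_sum_edgeless coef0 mul0r.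
rewrite big_ord_recl big_ord_recl /= !graph_sum_edgeless /= coef0 mul0r add0r.
rewrite -[(bump 0 0)`!]/1%N mul1n big1 ?addr0 // => i _.
by rewrite graph_sum_edgeless /= coef0 mul0r.
Qed.

(** The cut equation for the weighted number of graphs of degree d with n
    external and E internal edges. *)
Lemma graph_count_rec d n E :
  (2 * E.+1)%:R * graph_count d n E.+1 =
  (n.+2 * n.+1)%:R * graph_count d n.+2 E +
  \sum_(i < d.+1) \sum_(j < n.+3) \sum_(k < E.+1) (j * (n.+2 - j))%:R *
    (graph_count i j k * graph_count (d - i) (n.+2 - j) (E - k)).
Proof.
rewrite {1 2}/graph_count !mulr_sumr.
rewrite (eq_bigr (fun v : 'I_d.+1 => (n.+2 * n.+1)%:R * graph_coef v (E.*2 + n.+2) n.+2 d +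
  \sum_(i < d.+1) \sum_(c < (E.*2 + n.+2).+1) \sum_(j < n.+3)
   \sum_(a < v.+1)
    (j * (n.+2 - j))%:R *
      (graph_coef a c j i * graph_coef (v - a) (E.*2 + n.+2 - c) (n.+2 - j) (d - i)))); last first.
  move=> v _; have e : (E.+1.*2 + n = E.*2 + n.+2)%N by rewrite doubleS !addSn !addnS.
  transitivity ((E.+1.*2 + n - n)%:R * graph_coef v (E.+1.*2 + n) n d).
    by rewrite addnK -muln2 mulnC.
  rewrite graph_coef_rec e; congr (_ + _).
  rewrite exchange_big /=.
  under eq_bigr => c _.
    rewrite exchange_big /=; under eq_bigr => j _ do rewrite exchange_big /=.
    rewrite exchange_big /=.
  over.
  by rewrite exchange_big.
(* a component of degree i has at most i vertices, so the sums over vertex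
   numbers split into products although they are truncated at the degree *)
rewrite big_split /=; congr (_ + _); rewrite exchange_big /=; apply: eq_bigr => i _.
have le_id : (i <= d)%N by rewrite -ltnS.
have dE : (i + (d - i) = d)%N by rewrite subnKC.
rewrite exchange_big /=.
under eq_bigr => c _ do rewrite exchange_big /=.
rewrite exchange_big /=; apply: eq_bigr => j _.
have le_jn : (j <= n.+2)%N by rewrite -ltnS.
pose A c := \sum_(a < i.+1) graph_coef a c j i.
pose B c := \sum_(a < (d - i).+1) graph_coef a c (n.+2 - j) (d - i).
transitivity (\sum_(c < (E.*2 + n.+2).+1) (j * (n.+2 - j))%:R * (A c * B (E.*2 + n.+2 - c)%N)).
  apply: eq_bigr => c _; rewrite -(@sum_triangle _ (fun a => graph_coef a c j i)
    (fun a => graph_coef a (E.*2 + n.+2 - c) (n.+2 - j) (d - i))); last 2 first.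
  - by move=> a; exact: graph_coef_small.
  - by move=> a; exact: graph_coef_small.
  rewrite dE mulr_sumr; apply: eq_bigr => v _.
  by rewrite mulr_sumr.
have parity c m (q : nat) k : \sum_(a < q) graph_coef a c m k != 0 ->
    exists l, c = (l.*2 + m)%N.
  by case/sum_neq0 => a; exact: graph_coef_neq0.
rewrite (@sum_dilate _ (fun c => (j * (n.+2 - j))%:R * (A c * B (E.*2 + n.+2 - c)%N)) j E).
- apply: eq_bigr => k _; congr (_ * (_ * _)).
  have le_kE : (k <= E)%N by rewrite -ltnS.
  rewrite /B /graph_count; apply: eq_bigr => a _; congr graph_coef.
  by rewrite doubleB; have := le_kE; rewrite -leq_double; lia.
- move=> c; rewrite !mulf_eq0 !negb_or => /and3P[_ Ac Bc] ltc.
  have [k kE] := parity _ _ _ _ Ac; have [l lE] := parity _ _ _ _ Bc.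
  by exists k => //; lia.
- by lia.
Qed.

End Counts.

(** * From the cut equation to the effect of adding an external edge *)

(** In {poly {poly rat}} the outer variable is x and the inner one kappa, so the
    derivative in kappa is map_poly deriv. *)
Lemma map_deriv_mul (p q : {poly {poly rat}}) :
  map_poly deriv (p * q) = map_poly deriv p * q + p * map_poly deriv q.
Proof.
apply/polyP => i; rewrite coef_map coefD !coefM raddf_sum -big_split /=.
by apply: eq_bigr => j _; rewrite !coef_map derivM.
Qed.

Lemma map_deriv_comm (p : {poly {poly rat}}) :
  map_poly deriv p^`() = (map_poly deriv p)^`().
Proof. by apply/polyP => i; rewrite coef_map !coef_deriv coef_map raddfMn. Qed.

Lemma sum_sym (R : nmodType) (F : nat -> nat -> R) m :
  \sum_(i < m.+1) F i (m - i)%N = \sum_(i < m.+1) F (m - i)%N i.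
Proof.
rewrite (reindex_inj rev_ord_inj) /=; apply: eq_bigr => i _.
by rewrite subSS subKn // -ltnS.
Qed.

Lemma mulNrn_polyC (p : {poly rat}) n : - p *+ n = (- n%:R)%:P * p.
Proof. by rewrite mulNrn polyCN polyC_natr mulNr mulr_natl. Qed.

(** The cut equation and two properties of the graphs without internal edges
    are all that is used about the numbers a d n E of this section. *)
Section CutEquation.
Variable a : nat -> nat -> nat -> rat.
Hypothesis a_rec : forall d n E,
  (2 * E.+1)%:R * a d n E.+1 = (n.+2 * n.+1)%:R * a d n.+2 E +
  \sum_(i < d.+1) \sum_(j < n.+3) \sum_(k < E.+1) (j * (n.+2 - j))%:R *
    (a i j k * a (d - i) (n.+2 - j) (E - k)).
Hypothesis a_init_neq0 : forall d n, a d n 0 != 0 ->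
  [/\ (0 < d)%N, (n <= 3 * d)%N & odd d = odd n].

(** Bound and parity hold for E = 0 and are inherited through the cut equation:
    cutting an edge keeps d and 2E + n, and both are additive over components. *)
Lemma a_support d n E : a d n E != 0 ->
  [/\ (0 < d)%N, (E.*2 + n <= 3 * d)%N & odd d = odd n].
Proof.
elim/ltn_ind: E d n => -[_|E IH0] d n; first by rewrite double0 add0n; exact: a_init_neq0.
have IH := IH0 E (ltnSn E).
have IH1 d' n' E' : a d' n' E' != 0 -> (E' <= E)%N -> _ := fun h1 h2 => IH0 E' h2 d' n' h1.
move=> aE; have : (2 * E.+1)%:R * a d n E.+1 != 0 by rewrite mulf_neq0 // pnatr_eq0.
rewrite a_rec; case: (eqVneq (a d n.+2 E) 0) => [->|/IH[d0 b o] _]; last first.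
  by split; [| lia | rewrite o /= negbK].
rewrite mulr0 add0r => /sum_neq0[i /sum_neq0[j /sum_neq0[k]]].
rewrite !mulf_eq0 !negb_or => /and3P[_ /IH1 A /IH1 B].
have [/A[{A}i0 bi oi] /B[{B}d0 bd od]] := (ltn_ord k, leq_subr k E).
have [ltj lti] := (ltn_ord j, ltn_ord i).
split; lia.
Qed.

(** The generating polynomial f_d; the bounds come from a_support. *)
Definition gf d : {poly {poly rat}} :=
  \poly_(n < (3 * d).+1) \poly_(E < (3 * d).+1) a d n E.

Lemma coef_gf d n E : (gf d)`_n`_E = a d n E.
Proof.
have P : a d n E != 0 -> (n < (3 * d).+1)%N && (E < (3 * d).+1)%N.
  by case/a_support => _ b _; lia.
case: (eqVneq (a d n E) 0) => [a0|/P/andP[ltn ltE]].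
  by rewrite coef_poly; case: ifP => _; rewrite ?coef_poly ?coef0 // a0 if_same.
by rewrite coef_poly ltn coef_poly ltE.
Qed.

Lemma gf0 : gf 0 = 0.
Proof.
apply/polyP => n; apply/polyP => E; rewrite coef_gf !coef0; apply/eqP.
by apply: contraT => /a_support[].
Qed.

Lemma gf_cut d : 2 * map_poly deriv (gf d) =
  (gf d)^`()^`() + \sum_(i < d.+1) (gf i)^`() * (gf (d - i))^`().
Proof.
apply/polyP => n; apply/polyP => E.
rewrite mulr_natl !coefMn coef_map /= coef_deriv coef_gf -mulrnA -mulr_natl mulnC a_rec.
rewrite !coefD !coef_deriv !coefMn coef_gf -mulrnA -[in RHS]mulr_natl mulnC; congr (_ + _).
rewrite !coef_sum; apply: eq_bigr => i _.
rewrite coefM coef_sum.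
rewrite big_ord_recl /= big1 ?add0r; last by move=> k _; rewrite mul0n mul0r.
rewrite big_ord_recr /= [X in _ + X]big1 ?addr0; last first.
  by move=> k _; rewrite /bump /= subnn muln0 mul0r.
apply: eq_bigr => l _; rewrite coefM; apply: eq_bigr => k _.
rewrite !coef_deriv !coefMn !coef_gf /bump /= add1n.
have -> : (n.+2 - l.+1 = (n - l).+1)%N by have := ltn_ord l; lia.
by rewrite -![a _ _ _ *+ _]mulr_natl natrM; ring.
Qed.

(** Adding a marked point to a single vertex.  The right side comes from the
    unstable types (0, 2) and (1, 0), of degree 0, which acquire a point although
    they are not counted themselves. *)
Hypothesis a_init : forall d n, n.+1%:R * a d.+1 n.+1 0 + d%:R * a d n 0 =
  if d == 0%N then (n == 2%N)%:R / 2 - (n == 0%N)%:R / 12 else 0.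

Local Notation kappa := ('X%:P : {poly {poly rat}}).
Local Notation Dk := (map_poly (@deriv rat)).

Definition leg_source (d : nat) : {poly {poly rat}} :=
  if d == 0%N then (2^-1)%:P%:P * ('X^2 + kappa) - (12^-1)%:P%:P else 0.

(** What has to vanish for the identity describing the addition of an external
    edge. *)
Definition leg_defect d : {poly {poly rat}} :=
  (gf d.+1)^`() + d%:R * gf d - kappa * 'X * (gf d)^`() - kappa ^+ 2 * Dk (gf d)
  - leg_source d.

Let DkC c : Dk c%:P = (c^`())%:P.
Proof. exact: map_polyC. Qed.

Let DkD p q : Dk (p + q) = Dk p + Dk q.
Proof. exact: raddfD. Qed.

Let DkOpp p : Dk (- p) = - Dk p.
Proof. exact: raddfN. Qed.

Let DkB p q : Dk (p - q) = Dk p - Dk q.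
Proof. exact: raddfB. Qed.

Let DkX n : Dk 'X^n = 0.
Proof.
apply/polyP => i; rewrite coef_map coefXn coef0 /=.
by case: eqP => _; rewrite /= ?deriv0 // derivC.
Qed.

Lemma leg_source_pde d :
  2 * Dk (leg_source d) = (leg_source d)^`()^`() /\
  (leg_source d)^`() = if d == 0%N then 'X else 0.
Proof.
rewrite /leg_source; case: eqP => _; last by rewrite raddf0 mulr0 !deriv0.
have half : (2^-1)%:P%:P *+ 2 = 1 :> {poly {poly rat}}.
  by rewrite -!rmorphMn -[_ *+ 2]mulr_natr mulVf.
have e : ((2^-1)%:P%:P * ('X^2 + kappa) - (12^-1)%:P%:P)^`() = 'X :> {poly {poly rat}}.
  rewrite derivB derivM !derivC derivD derivXn derivC mul0r add0r addr0 subr0.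
  by rewrite expr1 mulrnAr -mulrnAl half mul1r.
split=> //; rewrite e derivX DkB map_deriv_mul DkD DkX !DkC !derivC derivX mul0r add0r subr0.
by rewrite add0r mulr1 mulr_natl half.
Qed.

(** The generating series F of the f_d satisfies 2 dF/dkappa = F'' + (F')^2,
    hence exp F solves the heat equation.  The projective transformations of the
    heat equation, with generator
    kappa^2 d/dkappa + x kappa d/dx + x^2/2 + kappa/2, the translations in x, the
    grading and the addition of constants are symmetries.  The defect is the
    variation of F under a combination of them, and so it solves the
    linearization of the equation at F. *)
Lemma leg_defect_pde d : 2 * Dk (leg_defect d) = (leg_defect d)^`()^`() +
  2 * \sum_(i < d.+1) (gf i)^`() * (leg_defect (d - i))^`().
Proof.
have DkK : Dk kappa = 1 by rewrite DkC derivX.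
have DkN n : Dk (n%:R) = 0 by rewrite -!polyC_natr DkC derivC.
have derivNat n : n%:R^`() = 0 :> {poly {poly rat}} by rewrite -polyC_natr derivC.
have deriv1 : 1^`() = 0 :> {poly {poly rat}} := derivC 1.
have [src1 _] := leg_source_pde d.
pose S1 := \sum_(i < d.+1) (gf i)^`() * (gf (d - i).+1)^`()^`().
pose S2 := \sum_(i < d.+1) (gf i)^`() * (gf (d - i))^`().
pose S3 := \sum_(i < d.+1) (gf i)^`() * (gf (d - i))^`()^`().
pose S4 := \sum_(i < d.+1) (gf i)^`() * Dk (gf (d - i))^`().
pose S5 := \sum_(i < d.+1) (d - i)%:R * ((gf i)^`() * (gf (d - i))^`()).
have cut2 : 2 * Dk (gf d) = (gf d)^`()^`() + S2 by exact: gf_cut.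
have cutD m : 2 * Dk (gf m)^`() = (gf m)^`()^`()^`() +
    2 * \sum_(i < m.+1) (gf i)^`() * (gf (m - i))^`()^`().
  have -> : 2 * Dk (gf m)^`() = (2 * Dk (gf m))^`().
    by rewrite map_deriv_comm !mulr_natl derivMn.
  rewrite gf_cut derivD raddf_sum /=; congr (_ + _).
  under eq_bigr do rewrite derivM; rewrite big_split /=.
  rewrite (sum_sym (fun i j => (gf i)^`()^`() * (gf j)^`())) mulr_natl mulr2n; congr (_ + _).
  by apply: eq_bigr => i _; rewrite mulrC.
have cut1 : 2 * Dk (gf d.+1)^`() = (gf d.+1)^`()^`()^`() + 2 * S1.
  rewrite cutD big_ord_recr /= subnn gf0 !deriv0 mulr0 addr0; congr (_ + 2 * _).
  by apply: eq_bigr => i _; rewrite subSn // -ltnS.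
have cut3 : 2 * Dk (gf d)^`() = (gf d)^`()^`()^`() + 2 * S3 := cutD d.
have cut4 : 2 * Dk (Dk (gf d)) = Dk (gf d)^`()^`() + 2 * S4.
  have -> : 2 * Dk (Dk (gf d)) = Dk (2 * Dk (gf d)).
    by rewrite map_deriv_mul DkN mul0r add0r.
  rewrite gf_cut DkD raddf_sum /=; congr (_ + _).
  under eq_bigr do rewrite map_deriv_mul; rewrite big_split /=.
  rewrite (sum_sym (fun i j => Dk (gf i)^`() * (gf j)^`())) mulr_natl mulr2n; congr (_ + _).
  by apply: eq_bigr => i _; rewrite mulrC.
(* the degrees i and d - i of the two factors average to d / 2 *)
have S5E : 2 * S5 = d%:R * S2.
  rewrite mulr_natl mulr2n {1}/S5.
  rewrite (sum_sym (fun i j => j%:R * ((gf i)^`() * (gf j)^`()))) -big_split mulr_sumr /=.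
  apply: eq_bigr => i _.
  have -> : d%:R = i%:R + (d - i)%:R :> {poly {poly rat}}.
    by rewrite -natrD subnKC // -ltnS.
  by rewrite mulrDl; congr (_ + _); rewrite [_ * (gf i)^`()]mulrC.
have sumE : \sum_(i < d.+1) (gf i)^`() * (leg_defect (d - i))^`() =
    S1 + S5 - kappa * S2 - kappa * 'X * S3 - kappa ^+ 2 * S4 - (gf d)^`() * 'X.
  transitivity (\sum_(i < d.+1) ((gf i)^`() * (gf (d - i).+1)^`()^`() +
     (d - i)%:R * ((gf i)^`() * (gf (d - i))^`()) - kappa * ((gf i)^`() * (gf (d - i))^`())
     - kappa * 'X * ((gf i)^`() * (gf (d - i))^`()^`())
     - kappa ^+ 2 * ((gf i)^`() * Dk (gf (d - i))^`())
     - (gf i)^`() * (leg_source (d - i))^`())).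
    apply: eq_bigr => i _; rewrite map_deriv_comm.
    rewrite /leg_defect !expr2.
    by rewrite !(derivD, derivN, derivM, derivX, derivC, derivNat, deriv1); ring.
  rewrite !sumrB big_split /= -!mulr_sumr; congr (_ - _).
  rewrite big_ord_recr /= subnn (leg_source_pde 0).2 big1 ?add0r // => i _.
  by rewrite (leg_source_pde _).2 subn_eq0 leqNgt ltn_ord mulr0.
rewrite sumE.
have -> : 2 * Dk (leg_defect d) = 2 * Dk (gf d.+1)^`() + d%:R * (2 * Dk (gf d))
   - 2 * 'X * (gf d)^`() - kappa * 'X * (2 * Dk (gf d)^`()) - 2 * kappa * (2 * Dk (gf d))
   - kappa ^+ 2 * (2 * Dk (Dk (gf d))) - 2 * Dk (leg_source d).
  have DkX1 : Dk 'X = 0 := DkX 1.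
  by rewrite /leg_defect !expr2 !(map_deriv_mul, DkD, DkOpp, DkK, DkX1, DkN); ring.
have -> : (leg_defect d)^`()^`() = (gf d.+1)^`()^`()^`() + d%:R * (gf d)^`()^`()
   - kappa * (2 * (gf d)^`()^`() + 'X * (gf d)^`()^`()^`()) - kappa ^+ 2 * Dk (gf d)^`()^`()
   - (leg_source d)^`()^`().
  rewrite /leg_defect !expr2.
  rewrite !(derivD, derivN, derivM, derivX, derivC, derivNat, deriv1) -!map_deriv_comm.
  by ring.
rewrite cut1 cut2 cut3 cut4 src1.
have -> : d%:R * ((gf d)^`()^`() + S2) = d%:R * (gf d)^`()^`() + 2 * S5 by rewrite S5E mulrDr.
ring.
Qed.

Lemma coef_leg_source d n : (leg_source d)`_n =
  if d == 0%N then (n == 2%N)%:R *: (2^-1)%:P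
    + (n == 0%N)%:R *: ((2^-1) *: 'X - (12^-1)%:P) else 0.
Proof.
rewrite /leg_source; case: eqP => _; last by rewrite coef0.
rewrite coefB coefCM coefD coefXn !coefC.
case: (eqVneq n 0%N) => [->|n0] /=.
  by rewrite !scale0r scale1r !add0r mul_polyC.
rewrite addr0 subr0 scale0r addr0; case: eqP => _; last by rewrite mulr0 scale0r.
by rewrite mulr1 scale1r.
Qed.

Lemma coef_leg_defect d n : (leg_defect d)`_n =
  (gf d.+1)`_n.+1 *+ n.+1 + (gf d)`_n *+ d - 'X * (gf d)`_n *+ n
  - 'X^2 * ((gf d)`_n)^`() - (leg_source d)`_n.
Proof.
rewrite /leg_defect !coefB coefD coef_deriv; congr (_ + _ - _ - _ - _).
- by rewrite mulr_natl coefMn.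
- rewrite -mulrA coefCM coefXM; case: n => [|n]; first by rewrite mulr0 mulr0n.
  by rewrite coef_deriv mulrnAr.
- by rewrite -rmorphXn coefCM coef_map.
Qed.

Lemma leg_defect_const d n : (leg_defect d)`_n`_0 = 0.
Proof.
rewrite coef_leg_defect !coefB coefD coefMn [in X in X - _]coefMn !coef_gf.
rewrite coefMn !coefXM /= mul0rn subr0 coefXnM /= subr0.
rewrite -![a _ _ _ *+ _]mulr_natl a_init coef_leg_source.
case: eqP => _; last by rewrite coef0 subr0.
rewrite coefD !coefZ coefC coefB coefZ coefX coefC mulr0 sub0r /=; ring.
Qed.

(** In leg_defect_pde the coefficient of kappa^(E+1) on the left is determined by
    coefficients of the defect of order at most E in kappa on the right. *)
Lemma leg_defect0 d : leg_defect d = 0.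
Proof.
suff H E n : (leg_defect d)`_n`_E = 0.
  by apply/polyP => n; apply/polyP => E; rewrite !coef0 H.
elim/ltn_ind: E d n => -[_|E IH] d n; first exact: leg_defect_const.
have : (2 * Dk (leg_defect d))`_n`_E = 0.
  rewrite leg_defect_pde coefD coefD [2 * _]mulr_natl !coefMn !coef_deriv !coefMn.
  rewrite IH // !mul0rn add0r.
  rewrite !coef_sum big1 ?mul0rn // => i _; rewrite coefM coef_sum big1 // => l _.
  rewrite coefM big1 // => k _.
  rewrite [(leg_defect _)^`()`_ _]coef_deriv coefMn IH ?mul0rn ?mulr0 //.
  by rewrite ltnS leq_subr.
rewrite mulr_natl !coefMn coef_map /= coef_deriv -mulrnA => /eqP.
by rewrite mulrn_eq0 /= => /eqP.
Qed.

Lemma add_leg d n : (gf d.+1)`_n.+1 *+ n.+1 =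
  - (gf d)`_n *+ d + 'X * (gf d)`_n *+ n + 'X^2 * ((gf d)`_n)^`() + (leg_source d)`_n.
Proof.
have := coef_leg_defect d n; rewrite leg_defect0 coef0 mulNrn.
move: (_ *+ n.+1) (_ *+ d) (_ *+ n) => L A B e.
by apply/eqP; rewrite -subr_eq0; apply/eqP; rewrite [RHS]e; ring.
Qed.

Definition closed_part g := (gf (2 * g - 2))`_0.

Lemma one_leg g : (1 < g)%N ->
  (gf (2 * g - 1))`_1 = kappa_op (2 - 2 * g%:R)%:P (closed_part g).
Proof.
move=> g1; have := add_leg (2 * g - 2) 0.
have -> : (2 * g - 2).+1 = (2 * g - 1)%N by lia.
have /negbTE d0 : (2 * g - 2)%N != 0%N by lia.
rewrite coef_leg_source d0 mulr1n mulr0n !addr0 => ->; congr (_ + _).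
rewrite mulNrn_polyC; congr (_%:P * _).
by rewrite natrB ?natrM; [ring | lia].
Qed.

(** Type (1, 1): the whole polynomial comes from the source, because no stable
    graph has degree 0. *)
Lemma one_leg1 : (gf 1)`_1 = (2^-1) *: 'X - (12^-1)%:P.
Proof.
have := add_leg 0 0; rewrite gf0 coef0 coef_leg_source /=.
by rewrite deriv0 !mulr0 !mul0rn oppr0 mul0rn scale0r scale1r !add0r mulr1n.
Qed.

Lemma two_legs g : (1 < g)%N -> (gf (2 * g))`_2 *+ 2 =
  kappa_op ((1 - 2 * g%:R)%:P + 'X) (kappa_op (2 - 2 * g%:R)%:P (closed_part g)).
Proof.
move=> g1; have := add_leg (2 * g - 1) 1; rewrite one_leg //.
have -> : (2 * g - 1).+1 = (2 * g)%N by lia.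
have /negbTE d0 : (2 * g - 1)%N != 0%N by lia.
rewrite coef_leg_source d0 addr0 => ->; set p := kappa_op _ (closed_part g).
rewrite [RHS]/kappa_op; congr (_ + _).
rewrite mulr1n [RHS]mulrDl; congr (_ + _).
rewrite mulNrn_polyC; congr (_%:P * _).
by rewrite natrB ?natrM; [ring | lia].
Qed.

(** By parity a component with one external edge has odd degree 2r - 1, so half
    of the terms of the convolution vanish. *)
Lemma cut_closed g : (1 < g)%N -> (closed_part g)^`() *+ 2 =
  (gf (2 * g - 2))`_2 *+ 2 +
  \sum_(1 <= r < g) (gf (2 * r - 1))`_1 * (gf (2 * (g - r) - 1))`_1.
Proof.
move=> g1; have /(congr1 (fun p : {poly {poly rat}} => p`_0)) := gf_cut (2 * g - 2).
rewrite mulr_natl coefMn coef_map coefD !coef_deriv => ->; congr (_ + _).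
rewrite coef_sum.
pose G c := (gf c)`_1 * (gf (2 * g - 2 - c))`_1.
transitivity (\sum_(c < (2 * g - 2).+1) G c).
  by apply: eq_bigr => c _; rewrite coefM big_ord1 !coef_deriv subn0.
have G0 c : G c != 0 -> odd c.
  rewrite mulf_eq0 negb_or -lead_coef_eq0 lead_coefE coef_gf.
  by case/andP => /a_support[_ _ ->].
rewrite (@sum_dilate _ G 1 (g - 2)); [|move=> c /G0 oc ltc|lia].
  rewrite -[1%N in RHS]add0n big_addn big_mkord.
  have -> : (g - 2).+1 = (g - 1)%N by lia.
  apply: eq_bigr => k _; rewrite /G; congr ((gf _)`_1 * (gf _)`_1); lia.
by exists c./2; lia.
Qed.

Lemma closed_part_rec g : (2 < g)%N ->
  closed_part g =
    (a (2 * g - 2) 0 0)%:P +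
    (1 / 2 : rat) *: poly_integral
      (kappa_op ((3 - 2 * g%:R)%:P + (2 : rat) *: 'X - (1 / 6)%:P)
         (kappa_op (4 - 2 * g%:R)%:P (closed_part (g - 1))) +
       \sum_(2 <= r < g - 1)
         kappa_op (2 - 2 * r%:R)%:P (closed_part r) *
         kappa_op (2 - 2 * g%:R + 2 * r%:R)%:P (closed_part (g - r))).
Proof.
move=> g3; set I := (X in poly_integral X).
have step : (closed_part g)^`() *+ 2 = I.
  rewrite cut_closed; last by lia.
  have gE : (g - 1).+1 = g by lia.
  have -> : (2 * g - 2 = 2 * (g - 1))%N by lia.
  rewrite two_legs; last by lia.
  rewrite big_ltn; last by lia.
  rewrite -[X in \sum_(_ <= _ < X) _]gE big_nat_recr /=; last by lia.
  have -> : (g - (g - 1) = 1)%N by lia.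
  rewrite muln1 subn1 /= one_leg1 one_leg; last by lia.
  rewrite (eq_big_nat _ _ (F2 := fun r => kappa_op (2 - 2 * r%:R)%:P (closed_part r) *
    kappa_op (2 - 2 * g%:R + 2 * r%:R)%:P (closed_part (g - r)))); last first.
    move=> r /andP[r2 rg]; rewrite !one_leg; [|lia..].
    congr (_ * kappa_op (_%:P) _); rewrite natrB; last by lia.
    by ring.
  rewrite /I -subn1; set T := \sum_(_ <= _ < _) _.
  have -> : 4 - 2 * g%:R = 2 - 2 * (g - 1)%:R :> rat.
    by rewrite natrB; [ring | lia].
  set q := kappa_op _ (closed_part (g - 1)).
  have -> : 3 - 2 * g%:R = 1 - 2 * (g - 1)%:R :> rat.
    by rewrite natrB; [ring | lia].
  set c := (1 - _)%:P; pose l : {poly rat} := 2^-1 *: 'X - (12^-1)%:P.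
  have ll : l + l = 'X - (1 / 6)%:P.
    rewrite addrACA -opprD -polyCD -scalerDl; congr (_ - _%:P).
    by rewrite -[RHS]scale1r; congr (_ *: _).
  have -> : c + (2 : rat) *: 'X - (1 / 6)%:P = c + 'X + (l + l).
    by rewrite ll -[2%R in LHS]/(1 + 1 : rat) scalerDl scale1r; ring.
  by rewrite -/l /kappa_op; ring.
apply/polyP => -[|E].
  by rewrite coefD coefZ coefC coefXM mulr0 addr0; exact: coef_gf.
rewrite coefD coefC add0r coefZ.
have := congr1 (fun p : {poly rat} => p`_E) (deriv_poly_integral I).
have := congr1 (fun p : {poly rat} => p`_E) step.
rewrite coefMn !coef_deriv => <- e.
apply: (@mulIf _ (E.+1%:R : rat)); first by rewrite pnatr_eq0.
rewrite -mulrA mulr_natr [_`_E.+1 * E.+1%:R]mulr_natr e -[X in _ * X]mulr_natr.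
by rewrite mulrCA div1r mulVf // mulr1.
Qed.

End CutEquation.

(** * Vertex weights *)

Lemma chi_M_add_leg g n : (2 < 2 * g + n)%N ->
  chi_M g n.+1 = - (2 * g + n - 2)%:R * chi_M g n.
Proof.
move=> st; rewrite /chi_M.
have -> : (2 * g + n.+1 - 3 = (2 * g + n - 3).+1)%N by lia.
have -> : (2 * g + n - 2 = (2 * g + n - 3).+1)%N by lia.
by rewrite factS natrM exprS; ring.
Qed.

Lemma chi_M_1_1 : chi_M 1 1 = - 12^-1.
Proof.
have b1 : 1 + (2 * bernoulli 1 + 0) = 0 :> rat.
  by have := bernoulli_rec 0; rewrite !big_ord_recl big_ord0.
have b2 : 1 + (3 * bernoulli 1 + (3 * bernoulli 2 + 0)) = 0 :> rat.
  by have := bernoulli_rec 1; rewrite !big_ord_recl big_ord0.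
have {b1 b2} b2 : bernoulli 2 = 6^-1 by lra.
by rewrite /chi_M b2.
Qed.

Lemma chi_M_closed g : (1 < g)%N ->
  chi_M g 0 = bernoulli (2 * g) / ((2 * g%:R) * (2 * g%:R - 2)).
Proof.
move=> g1; rewrite /chi_M expr0 mul1r addn0.
set m := (2 * g - 3)%N; have gE : (2 * g = m + 3)%N by lia.
rewrite -natrM gE addn3 !factS !natrM -addn3 -[in X in _ / X](addn1 m.+1) -[m.+1]addn1 !natrD.
have m0 : 0 <= m%:R :> rat by exact: ler0n.
have f0 : (m`!)%:R != 0 :> rat by rewrite pnatr_eq0 -lt0n fact_gt0.
by field; apply/and4P; split=> //; apply: lt0r_neq0; lra.
Qed.

Section VertexPolynomial.
Variable N : nat.

(** The genus is summed out and kept track of by the exponent; truncating at N is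
    harmless as long as the total genus is below N. *)
Definition vertex_poly (n : nat) : {poly rat} :=
  \sum_(g < N | (2 < 2 * g + n)%N) chi_M g n *: 'X^(2 * g + n - 2).

Lemma coef_vertex_poly n d : (vertex_poly n)`_d =
  \sum_(g < N | (2 < 2 * g + n)%N && (d == 2 * g + n - 2)%N) chi_M g n.
Proof.
rewrite coef_sum big_mkcondr; apply: eq_bigr => g _.
by rewrite coefZ coefXn; case: eqP; rewrite ?mulr1 ?mulr0.
Qed.

Lemma vertex_poly_coef0 n : (vertex_poly n)`_0 = 0.
Proof. by rewrite coef_vertex_poly big_pred0 // => g; apply/negP => /andP[]; lia. Qed.

Local Notation count := (graph_count vertex_poly).

Lemma count_init_neq0 d n : count d n 0 != 0 ->
  [/\ (0 < d)%N, (n <= 3 * d)%N & odd d = odd n].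
Proof.
rewrite graph_count0; case: (eqVneq d 0%N) => [->|d0]; first by rewrite eqxx.
rewrite mulf_eq0 negb_or coef_vertex_poly => /andP[s0 _].
case: (pickP (fun g : 'I_N => (2 < 2 * g + n)%N && (d == 2 * g + n - 2)%N))
  => [g /andP[st /eqP dE]|P0].
  by split; lia.
by rewrite big_pred0 ?eqxx in s0.
Qed.

Lemma count_init_rec d n : (1 < N)%N -> n.+1%:R * count d.+1 n.+1 0 + d%:R * count d n 0 =
  if d == 0%N then (n == 2%N)%:R / 2 - (n == 0%N)%:R / 12 else 0.
Proof.
move=> N1; rewrite !graph_count0 /= !coef_vertex_poly.
have facE x : n.+1%:R * (x / (n.+1)`!%:R) = x / n`!%:R :> rat.
  by rewrite factS natrM invfM mulrCA mulVKf ?pnatr_eq0.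
rewrite facE; case: (eqVneq d 0%N) => [->|d0]; last first.
  apply/eqP; rewrite addr_eq0; apply/eqP; rewrite mulrA -[RHS]mulNr; congr (_ / _).
  rewrite mulr_sumr -sumrN; apply: eq_big => g; first by lia.
  move=> /andP[st /eqP e]; rewrite chi_M_add_leg; last by lia.
  rewrite mulNr; congr (- (_%:R * _)); lia.
rewrite mul0r addr0.
case: N N1 => [|[|M]] // _; rewrite big_mkcond !big_ord_recl /= big1 ?addr0; last first.
  by move=> i _; case: ifP => // /andP[_ /eqP]; rewrite /bump /=; lia.
case: n {facE} => [|[|[|n]]] //=.
- by rewrite add0r chi_M_1_1 fact0; field.
- by rewrite !(add0r, mul0r, subr0).
Qed.

Lemma count_single_vertex g : (1 < g < N)%N -> count (2 * g - 2) 0 0 = chi_M g 0.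
Proof.
move=> /andP[g1 gN]; rewrite graph_count0 ifF; last by lia.
rewrite divr1 coef_vertex_poly (big_pred1 (Ordinal gN)) // => r /=.
by rewrite -val_eqE /=; lia.
Qed.

End VertexPolynomial.

(** * Invariants of stable graphs *)

Section GraphInvariants.
Variable G : stable_graph.

Definition gluing_of : gluing 'I_(sg_nv G) 'I_(sg_nh G) :=
  (sg_root G, perm (inv_inj (@sg_oppK G))).

Lemma gluing_of_opp h : gluing_of.2 h = sg_opp G h.
Proof. exact: permE. Qed.

Lemma involutiveb_gluing_of : involutiveb gluing_of.
Proof. by apply/involutivebP => h; rewrite !gluing_of_opp sg_oppK. Qed.

Lemma external_edgesE : external_edges G = legs gluing_of.
Proof. by apply/setP => h; rewrite !inE gluing_of_opp. Qed.

Lemma card_edges : (2 * #|edges G| = #|~: legs gluing_of|)%N.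
Proof.
rewrite (card_nonlegs involutiveb_gluing_of) mulnC; congr (#|pred_of_set _| * 2)%N.
apply/setP => A; apply/imsetP/imsetP => -[h].
  by rewrite inE => oh ->; exists h; rewrite ?inE gluing_of_opp.
by rewrite !inE gluing_of_opp => oh ->; exists h; rewrite ?inE.
Qed.

Lemma card_half_edges : (#|legs gluing_of| + 2 * #|edges G| = sg_nh G)%N.
Proof. by rewrite card_edges cardsC card_ord. Qed.

Lemma connect_closed v w S : connect (@adjacent G) v w ->
  closed_set gluing_of S -> v \in S -> w \in S.
Proof.
move=> /connectP[p pP ->] /closed_setP cS; elim: p v pP => //= v' p IH v.
case/andP => /existsP[h /andP[/eqP <- /eqP <-]] pP vS; apply: IH pP _.
by rewrite -gluing_of_opp cS.
Qed.

Lemma adjacent_sym : symmetric (@adjacent G).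
Proof.
move=> v w; apply/existsP/existsP => -[h /andP[a b]]; exists (sg_opp G h);
  by rewrite sg_oppK b a.
Qed.

Lemma connected_graphE : connected_graph G <-> component gluing_of setT.
Proof.
split=> [[n0 c]|c].
  apply: componentP.
  - by apply/closed_setP => h; rewrite !inE.
  - by apply/set0Pn; exists (Ordinal n0); rewrite inE.
  - move=> U _ cU /set0Pn[v vU]; apply/setP => w.
    by rewrite inE (connect_closed (c v w) cU vU).
have /and3P[/set0Pn[v0 _] _ _] := c.
split; first exact: leq_ltn_trans (leq0n _) (ltn_ord v0).
move=> v w; have cl : closed_set gluing_of [set u | connect (@adjacent G) v u].
  apply/closed_setP => h; rewrite gluing_of_opp !inE; apply: same_connect1r.
    exact: sym_connect_sym adjacent_sym.
  by apply/existsP; exists (sg_opp G h); rewrite sg_oppK !eqxx.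
have [E|E] := component_min c (subsetT _) cl.
  by move/setP/(_ v): E; rewrite !inE connect0.
by move/setP/(_ w): E; rewrite !inE.
Qed.

(** The kernel of the coboundary consists of the functions whose level sets are
    closed: the constants if the graph is connected. *)
Lemma rank_coboundary : connected_graph G -> \rank (coboundary G) = (sg_nv G - 1)%N.
Proof.
move=> /[dup] -[n0 _] /connected_graphE c.
have ker (f : 'rV[rat]_(sg_nv G)) : (f *m coboundary G == 0) =
    (f <= (const_mx 1 : 'rV[rat]_(sg_nv G)))%MS.
  have fE h : (f *m coboundary G) 0 h = f 0 (sg_root G (sg_opp G h)) - f 0 (sg_root G h).
    have pick c' : \sum_v f 0 v * (c' == v)%:R = f 0 c'.
      rewrite (bigD1 c') //= eqxx mulr1 big1 ?addr0 // => v.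
      by rewrite eq_sym => /negbTE ->; rewrite mulr0.
    by rewrite mxE; under eq_bigr do rewrite mxE mulrBr; rewrite sumrB !pick.
  apply/eqP/sub_rVP => [f0|[c' fc]]; last first.
    by apply/rowP => h; rewrite fE fc !mxE subrr.
  exists (f 0 (Ordinal n0)).
  have cl : closed_set gluing_of [set v | f 0 v == f 0 (Ordinal n0)].
    apply/closed_setP => h; rewrite gluing_of_opp !inE; congr (_ == _).
    by apply/eqP; rewrite -subr_eq0 -fE f0 mxE.
  apply/rowP => v; rewrite !mxE mulr1.
  have [/setP/(_ (Ordinal n0))|/setP/(_ v)] := component_min c (subsetT _) cl.
    by rewrite !inE eqxx.
  by rewrite !inE => /eqP.
have kE : (kermx (coboundary G) :=: (const_mx 1 : 'rV[rat]_(sg_nv G)))%MS.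
  apply/eqmxP/andP; split.
    by apply/row_subP => i; rewrite -ker -row_mul mulmx_ker row0.
  by apply/sub_kermxP/eqP; rewrite ker.
have := mxrank_ker (coboundary G); rewrite kE.
have -> : \rank (const_mx 1 : 'rV[rat]_(sg_nv G)) = 1%N.
  rewrite rank_rV; case: eqP => // /rowP/(_ (Ordinal n0)); rewrite !mxE => /eqP.
  by rewrite oner_eq0.
have := rank_leq_row (coboundary G); lia.
Qed.

(** The columns of the two halves of an edge are opposite and those of external
    half-edges vanish, so the matrix factors through one column per edge. *)
Lemma rank_coboundary_le : (\rank (coboundary G) <= #|edges G|)%N.
Proof.
pose rep (A : {set 'I_(sg_nh G)}) := [pick h in A].
pose B : 'M[rat]_(sg_nv G, #|edges G|) := \matrix_(v, e)
  if rep (enum_val e) is Some h then coboundary G v h else 0.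
pose C : 'M[rat]_(#|edges G|, sg_nh G) := \matrix_(e, h)
  if enum_val e == [set h; sg_opp G h] then
    if rep (enum_val e) == Some h then 1 else -1 else 0.
suff -> : coboundary G = B *m C.
  by apply: leq_trans (mxrankM_maxl _ _) _; apply: rank_leq_col.
apply/matrixP => v h; rewrite [RHS]mxE.
case: (eqVneq (sg_opp G h) h) => [oh|oh].
  rewrite !mxE oh subrr; symmetry; apply: big1 => e _; rewrite !mxE.
  have /imsetP[k] := enum_valP e; rewrite inE => ok ->.
  rewrite ifF ?mulr0 //; apply: contraNF ok => /eqP E.
  have := congr1 (fun A : {set _} => #|A|) E.
  by rewrite oh setUid cards1 cards2 eq_sym; case: (_ == _).
have eh : [set h; sg_opp G h] \in edges G by apply: imset_f; rewrite inE.
rewrite (bigD1 (enum_rank_in eh [set h; sg_opp G h])) //= big1 ?addr0 => [|e ne]; last first.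
  rewrite [C _ _]mxE ifF ?mulr0 //; apply: contra_neqF ne => /eqP E.
  by apply: enum_val_inj; rewrite enum_rankK_in.
rewrite [B _ _]mxE [C _ _]mxE enum_rankK_in // eqxx /rep.
case: pickP => [k|/(_ h)]; last by rewrite !inE eqxx.
rewrite !inE => /orP[]/eqP ->; first by rewrite eqxx mulr1.
rewrite ifF; last by apply/eqP => -[/eqP]; rewrite (negbTE oh).
by rewrite !mxE sg_oppK mulrN1 opprB.
Qed.

(** Equal to 2g - 2 + n for a connected graph of genus g with n external edges. *)
Definition graph_degree : nat := (\sum_(v < sg_nv G) (2 * sg_genus G v + valence v - 2))%N.

Lemma sum_valence : sg_nh G = (\sum_(v < sg_nv G) valence v)%N.
Proof.
rewrite -[LHS]card_ord -sum1_card (partition_big (sg_root G) predT) //=.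
by apply: eq_bigr => v _; rewrite sum1dep_card.
Qed.

Lemma graph_degreeE :
  (graph_degree + 2 * sg_nv G = 2 * \sum_(v < sg_nv G) sg_genus G v + sg_nh G)%N.
Proof.
rewrite sum_valence.
rewrite -[X in (2 * X)%N](card_ord (sg_nv G)) -sum1_card !big_distrr -!big_split /=.
by apply: eq_bigr => v _; have := sg_stable v; rewrite /valence /=; lia.
Qed.

(** The truncated subtraction in the definition of h1 is a genuine one because
    the rank of the coboundary is at most the number of edges. *)
Lemma graph_genusE g : (0 < g)%N -> connected_graph G -> external_edges G = set0 ->
  (graph_genus G == g) = (graph_degree == 2 * g - 2)%N.
Proof.
move=> g0 cG ext; have [n0 _] := cG.
have := rank_coboundary_le; rewrite rank_coboundary // => le.
have := card_edges; rewrite -external_edgesE ext setC0 cardsT card_ord => eE.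
have := graph_degreeE; rewrite /graph_genus /h1 rank_coboundary //.
set S := (\sum_(v < sg_nv G) _)%N; rewrite -[X in (_ + X == _)%N]/S.
by move: (graph_degree) (sg_nv G) (sg_nh G) (#|edges G|) S n0 le eE => *; lia.
Qed.

Lemma nv_le_degree : (sg_nv G <= graph_degree)%N.
Proof.
rewrite -[X in (X <= _)%N]card_ord -sum1_card; apply: leq_sum => v _.
by have := sg_stable v; rewrite /valence; lia.
Qed.

Lemma nh_le_degree : (sg_nh G <= 3 * graph_degree)%N.
Proof.
rewrite sum_valence big_distrr; apply: leq_sum => v _ /=.
by have := sg_stable v; rewrite /valence; lia.
Qed.

Lemma genus_le_degree v : (2 * sg_genus G v <= graph_degree + 2)%N.
Proof. by rewrite /graph_degree (bigD1 v) //=; lia. Qed.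

End GraphInvariants.

(** * Labelled graphs and isomorphism classes *)

Section LabelledGraphs.
Variables N V H : nat.

Definition stable_data (z : {ffun 'I_V -> 'I_N} * gluing 'I_V 'I_H) :=
  involutiveb z.2 && [forall v, 2 < 2 * z.1 v + #|[set h | z.2.1 h == v]|]%N.

Definition labelled_graph : finType := {z | stable_data z}.

Implicit Types z : labelled_graph.

Lemma labelled_oppK z : involutive [ffun h => (val z).2.2 h].
Proof.
move=> h; rewrite !ffunE; have /andP[/involutivebP zK _] := valP z.
exact: zK.
Qed.

Lemma labelled_stable z (v : 'I_V) :
  (2 < 2 * [ffun v => nat_of_ord ((val z).1 v)] v + #|[set h | (val z).2.1 h == v]|)%N.
Proof. by rewrite ffunE; have /andP[_ /forallP/(_ v)] := valP z. Qed.

Definition graph_of z : stable_graph :=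
  StableGraph (@labelled_oppK z) (labelled_stable z).

End LabelledGraphs.

Lemma isomorphic_size (G1 G2 : stable_graph) : isomorphic G1 G2 ->
  sg_nv G1 = sg_nv G2 /\ sg_nh G1 = sg_nh G2.
Proof.
move=> [s [t [[s' sK s'K] [t' tK t'K] _]]].
have := bij_eq_card (Bijective sK s'K); have := bij_eq_card (Bijective tK t'K).
by rewrite !card_ord.
Qed.

(** Orbit-stabilizer: a pair of permutations transports G to exactly one
    labelled graph, and the pairs leading to a given one form a coset of the
    automorphism group. *)
Lemma card_isomorphic_labelled (N : nat) (G : stable_graph) :
  (forall v, sg_genus G v < N)%N ->
  (#|[set z : labelled_graph N (sg_nv G) (sg_nh G) | `[< isomorphic G (graph_of z) >]]| *
   #|automorphisms G|)%N = ((sg_nv G)`! * (sg_nh G)`!)%N.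
Proof.
move=> ltN.
pose P := ({perm 'I_(sg_nv G)} * {perm 'I_(sg_nh G)})%type.
pose pres (st : P) (z : labelled_graph N (sg_nv G) (sg_nh G)) :=
  graph_morphism (G2 := graph_of z) st.1 st.2.
have isoP z : `[< isomorphic G (graph_of z) >] = [exists st, pres st z].
  apply/asboolP/existsP => [[s [t [/bij_inj si /bij_inj ti]]]|[st m]].
    case/and3P => /forallP a /forallP b /forallP c.
    by exists (perm si, perm ti); apply/and3P; split; apply/forallP => x /=; rewrite !permE.
  by exists st.1, st.2; split=> //; apply: injF_bij; exact: perm_inj.
have ex st : exists z, pres st z.
  case: st => s t.
  pose x : gluing 'I_(sg_nv G) 'I_(sg_nh G) :=
    ([ffun h => s (sg_root G ((t^-1)%g h))], (t^-1 * (gluing_of G).2 * t)%g).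
  pose d := ([ffun v => Ordinal (ltN ((s^-1)%g v))], x).
  have sd : stable_data d.
    apply/andP; split.
      apply/involutivebP => h /=; rewrite !permM permK.
      by have /involutivebP -> := involutiveb_gluing_of G; rewrite permKV.
    apply/forallP => v; rewrite ffunE /=.
    have := sg_stable ((s^-1)%g v); congr (_ < _ + _)%N.
    rewrite -(card_imset _ (@perm_inj _ t)); apply: eq_card => h; rewrite !inE ffunE.
    apply/imsetP/eqP => [[h']|E].
      by rewrite inE => /eqP E ->; rewrite permK E permKV.
    by exists ((t^-1)%g h); rewrite ?permKV // inE -E permK.
  exists (Sub d sd); apply/and3P; split; apply/forallP => i /=; rewrite !ffunE.
  - by rewrite permK.
  - by rewrite permK.
  - by rewrite !permM permK permE.
have pres_uniq st z z' : pres st z -> pres st z' -> z = z'.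
  move=> /and3P[/forallP a /forallP b /forallP c] /and3P[/forallP a' /forallP b' /forallP c'].
  apply: val_inj; rewrite [val z]surjective_pairing [val z']surjective_pairing.
  rewrite [(val z).2]surjective_pairing [(val z').2]surjective_pairing.
  congr (_, (_, _)).
  - apply/ffunP => v; apply: val_inj; have := a ((st.1^-1)%g v); have := a' ((st.1^-1)%g v).
    by rewrite /= !ffunE permKV => /eqP -> /eqP ->.
  - apply/ffunP => h; have := b ((st.2^-1)%g h); have := b' ((st.2^-1)%g h).
    by rewrite /= permKV => /eqP -> /eqP ->.
  - apply/perm.permP => h; have := c ((st.2^-1)%g h); have := c' ((st.2^-1)%g h).
    by rewrite /= !ffunE permKV => /eqP -> /eqP ->.
have fiber z st0 : pres st0 z -> (\sum_(st | pres st z) 1 = #|automorphisms G|)%N.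
  move=> p0.
  have inj : injective (fun st : P => (st.1 * st0.1, st.2 * st0.2)%g : P).
    by move=> [s t] [s' t'] [/mulIg -> /mulIg ->].
  rewrite (reindex_inj inj) /= -sum1_card; apply: eq_bigl => -[s t]; rewrite inE /=.
  have /and3P[/forallP a /forallP b /forallP c] := p0.
  apply/and3P/and3P => -[/forallP a' /forallP b' /forallP c']; split; apply/forallP => i.
  - by have := a' i; rewrite permM (eqP (a _)).
  - by have := b' i; rewrite !permM (eqP (b _)) (inj_eq perm_inj).
  - by have := c' i; rewrite !permM (eqP (c _)) (inj_eq perm_inj).
  - by rewrite permM (eqP (a _)); exact: a'.
  - by rewrite !permM (eqP (b _)) (inj_eq perm_inj); exact: b'.
  - by rewrite !permM (eqP (c _)) (inj_eq perm_inj); exact: c'.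
transitivity (\sum_(st : P) 1)%N; last first.
  by rewrite sum1_card card_prod !card_Sn.
transitivity (\sum_(st : P) \sum_(z | pres st z) 1)%N; last first.
  apply: eq_bigr => st _; have [z pz] := ex st.
  rewrite (big_pred1 z) // => z'; apply/idP/eqP => [p|-> //]; exact: pres_uniq p pz.
rewrite (exchange_big_dep predT) //=.
rewrite [RHS](bigID (fun z => [exists st, pres st z])) /=.
rewrite [X in (_ + X)%N]big1 ?addn0; last first.
  by move=> z /existsPn nz; rewrite big_pred0 // => st; apply/negbTE.
rewrite -sum_nat_const; apply: eq_big => z; rewrite inE isoP //.
by move=> /existsP[st0 p0]; rewrite (fiber _ _ p0).
Qed.

Lemma gluing_of_labelled N V H (z : labelled_graph N V H) :
  gluing_of (graph_of z) = (val z).2.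
Proof.
rewrite [RHS]surjective_pairing; congr pair; apply/perm.permP => h.
by rewrite gluing_of_opp /= ffunE.
Qed.

Lemma isomorphic_invariants G1 G2 : isomorphic G1 G2 ->
  [/\ component (gluing_of G1) setT = component (gluing_of G2) setT,
      #|legs (gluing_of G1)| = #|legs (gluing_of G2)|,
      graph_degree G1 = graph_degree G2,
      #|edges G1| = #|edges G2| &
      \prod_(v < sg_nv G1) chi_M (sg_genus G1 v) (valence v) =
      \prod_(v < sg_nv G2) chi_M (sg_genus G2 v) (valence v)].
Proof.
move=> iso; have [_ nhE] := isomorphic_size iso.
have [s [t [bs bt /and3P[/forallP a /forallP b /forallP c]]]] := iso.
have [si ti] := (bij_inj bs, bij_inj bt).
have im (A B : finType) (f : A -> B) : bijective f -> f @: setT = setT.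
  move=> [f' fK f'K]; apply/setP => x; rewrite inE; apply/imsetP.
  by exists (f' x); rewrite ?f'K.
have cov h : ((gluing_of G2).1 h \in s @: setT) = (h \in t @: setT).
  by rewrite !im // !inE.
have r : restricts s t (gluing_of G2) (gluing_of G1).
  apply/andP; split; apply/forallP => h; first exact: b.
  by rewrite !gluing_of_opp; exact: c.
have lE : #|legs (gluing_of G1)| = #|legs (gluing_of G2)|.
  rewrite -(card_legs ti cov r); apply: eq_card => h.
  by rewrite !inE im // inE andbT.
have valE v : valence (s v) = valence v := card_fiber si ti cov r v.
split=> //.
- by rewrite -(component_codom si cov r) im.
- rewrite /graph_degree (reindex s) /=; last exact: onW_bij.
  by apply: eq_bigr => v _; rewrite valE (eqP (a v)).
- have := etrans (card_half_edges G1) (etrans nhE (esym (card_half_edges G2))).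
  by rewrite lE => /addnI/eqP; rewrite eqn_mul2l /= => /eqP.
- rewrite [RHS](reindex s) /=; last exact: onW_bij.
  by apply: eq_bigr => v _; rewrite valE (eqP (a v)).
Qed.

Definition closed_graph (d : nat) (G : stable_graph) :=
  [&& component (gluing_of G) setT, #|legs (gluing_of G)| == 0%N & graph_degree G == d].

(** Expanding the product over the vertices of the vertex polynomials chooses a
    genus for each vertex. *)
Lemma coef_graph_sum N V b d : (graph_sum (vertex_poly N) V b 0)`_d =
  \sum_(z : labelled_graph N V b | closed_graph d (graph_of z))
    \prod_(v < V) chi_M ((val z).1 v) #|[set h | (val z).2.1 h == v]|.
Proof.
pose st (x : gluing 'I_V 'I_b) (v : 'I_V) (g : 'I_N) := (2 < 2 * g + #|[set h | x.1 h == v]|)%N.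
pose deg (x : gluing 'I_V 'I_b) (f : {ffun 'I_V -> 'I_N}) :=
  (\sum_v (2 * f v + #|[set h | x.1 h == v]| - 2))%N.
transitivity (\sum_(x : gluing 'I_V 'I_b | graph_on 0 x)
   \sum_(f : {ffun 'I_V -> 'I_N} | [forall v, st x v (f v)] && (d == deg x f))
     \prod_v chi_M (f v) #|[set h | x.1 h == v]|).
  rewrite coef_sum; apply: eq_bigr => x _.
  rewrite /weight /vertex_poly bigA_distr_big_dep coef_sum big_mkcondr.
  apply: eq_big => f.
    apply/familyP/forallP => p v; first exact: p v. exact: p v.
  move=> _; rewrite scaler_prod -expr_sum coefZ coefXn /deg.
  by case: eqP => _; rewrite ?mulr1 ?mulr0.
rewrite pair_big_dep /=.
symmetry.
apply: (sum_correspondence (r := fun (z : labelled_graph N V b) p => val z == (p.2, p.1))).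
- by move=> z _; exists ((val z).2, (val z).1); rewrite -surjective_pairing.
- move=> [x f] /andP[/= /and3P[ix _ _] /andP[sf _]].
  have sd : stable_data (f, x) by rewrite /stable_data ix.
  by exists (exist _ (f, x) sd).
- move=> z [x f] /eqP zE; rewrite /closed_graph gluing_of_labelled /graph_on zE /=.
  have := valP z; rewrite zE => /andP[/= -> sx].
  have -> : [forall v, st x v (f v)] by exact: sx.
  rewrite /= -andbA; do 2 congr andb; rewrite eq_sym; congr (_ == _).
  by apply: eq_bigr => v _; rewrite /= ffunE /valence /= zE.
- by move=> z [x f] [x' f'] /eqP zE /eqP; rewrite zE /= => -[-> ->].
- by move=> z z' p /eqP zE /eqP zE'; apply: val_inj; rewrite zE zE'.
- by move=> z [x f] _ /eqP zE; apply: eq_bigr => v _; rewrite zE.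
Qed.

Lemma isomorphic_repr G : isomorphic (repr (\pi_iso_class G)) G.
Proof.
by have /eqmodP/asboolP : repr (\pi_iso_class G) = G %[mod iso_class] by rewrite reprK.
Qed.

Lemma iso_class_eq G (C : iso_class) : (\pi_iso_class G == C) = `[< isomorphic (repr C) G >].
Proof.
rewrite -[C in LHS]reprK; apply/eqP/asboolP => [/eqmodP/asboolP|] /isomorphic_sym //.
by move=> iGC; apply/eqmodP/asboolP.
Qed.

Section ClassSum.
Variables N g E : nat.
Hypotheses (g_gt0 : (0 < g)%N) (g_ltN : (g < N)%N).
Let d := (2 * g - 2)%N.
Let M := d.+1.
Let M' := (3 * d + E.*2).+1.

(** All labelled graphs within the bounds satisfied by closed graphs of degree d;
    the number of half-edges also runs up to 2E so that E internal edges fit. *)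
Definition labelled_family := {V : 'I_M & {H : 'I_M' & labelled_graph N V H}}.

Definition family_graph (t : labelled_family) : stable_graph := graph_of (tagged (tagged t)).

(** An enumeration of the classes over which refined_chi sums; in particular
    there are finitely many. *)
Definition family_classes : seq iso_class :=
  undup [seq \pi_iso_class (family_graph t) |
         t <- enum (fun t => closed_graph d (family_graph t))].

Definition family_embed (V : 'I_M) (H : 'I_M') (z : labelled_graph N V H) : labelled_family :=
  Tagged (fun V : 'I_M => {H : 'I_M' & labelled_graph N V H})
    (Tagged (fun H : 'I_M' => labelled_graph N V H) z).

Lemma family_embed_inj V H : injective (@family_embed V H).
Proof. by move=> z z' /eqP; rewrite !eq_Tagged /= => /eqP. Qed.

Lemma closed_graph_iso G1 G2 : isomorphic G1 G2 -> closed_graph d G1 = closed_graph d G2.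
Proof. by move=> /isomorphic_invariants[a b c _ _]; rewrite /closed_graph a b c. Qed.

Lemma connected_stable_graphsE (C : iso_class) :
  connected_stable_graphs g 0 C <-> closed_graph d (repr C).
Proof.
split=> [[cG gG /eqP]|/and3P[cG lG dG]].
  rewrite cards_eq0 => /eqP ext; rewrite /closed_graph -external_edgesE ext cards0 eqxx.
  by rewrite -graph_genusE // gG eqxx !andbT; apply/connected_graphE.
move/connected_graphE: cG => cG.
have ext : external_edges (repr C) = finset.set0.
  by apply/eqP; rewrite -cards_eq0 external_edgesE.
split=> //; last by rewrite ext cards0.
by apply/eqP; rewrite graph_genusE.
Qed.

Lemma closed_graph_bounds G : closed_graph d G ->
  [/\ (sg_nv G < M)%N, (sg_nh G < M')%N & forall v, (sg_genus G v < N)%N].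
Proof.
case/and3P => _ _ /eqP dG; split; first by rewrite ltnS -dG nv_le_degree.
  by rewrite ltnS -dG; apply: leq_trans (nh_le_degree _) (leq_addr _ _).
by move=> v; have := genus_le_degree v; rewrite dG /d; lia.
Qed.

Lemma mem_family_classes C : (C \in family_classes) = closed_graph d (repr C).
Proof.
rewrite mem_undup; apply/mapP/idP => [[t]|cC].
  by rewrite mem_enum => ct ->; rewrite (closed_graph_iso (isomorphic_repr _)).
have [ltV ltH ltg] := closed_graph_bounds cC.
have := card_isomorphic_labelled ltg.
set A := finset _; case: (set_0Vmem A) => [-> | [z]].
  by rewrite cards0 mul0n => /esym/eqP; rewrite muln_eq0 !eqn0Ngt !fact_gt0.
rewrite inE => iz _.
exists (@family_embed (Ordinal ltV) (Ordinal ltH) z).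
  have cz : closed_graph d (graph_of z) by rewrite -(closed_graph_iso (asboolW iz)).
  by rewrite mem_enum.
by apply/esym/eqP; rewrite iso_class_eq.
Qed.

Definition labelled_term (G : stable_graph) : rat :=
  (#|edges G| == E)%:R * \prod_(v < sg_nv G) chi_M (sg_genus G v) (valence v) /
  ((sg_nv G)`! * (sg_nh G)`!)%:R.

Lemma coef_graph_weight C : closed_graph d (repr C) ->
  (graph_weight (repr C))`_E =
  \sum_(t | closed_graph d (family_graph t) && (\pi_iso_class (family_graph t) == C))
    labelled_term (family_graph t).
Proof.
set G := repr C => cG; have [ltV ltH ltg] := closed_graph_bounds cG.
pose emb := @family_embed (Ordinal ltV) (Ordinal ltH).
transitivity (\sum_(z : labelled_graph N (sg_nv G) (sg_nh G) | `[< isomorphic G (graph_of z) >])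
    labelled_term G); last first.
  symmetry; apply: (sum_correspondence (r := fun t z => t == emb z)).
  - case=> V [H z] /=; rewrite iso_class_eq => /andP[_ /asboolP/isomorphic_size /= [eV eH]].
    have VE : V = Ordinal ltV by apply: val_inj.
    have HE : H = Ordinal ltH by apply: val_inj.
    by move: z; rewrite {}VE {}HE => z; exists z.
  - by move=> z _; exists (emb z).
  - move=> t z /eqP ->; rewrite iso_class_eq andb_idl // => /asboolP iz.
    by rewrite -(closed_graph_iso iz).
  - by move=> t z z' /eqP -> /eqP/family_embed_inj.
  - by move=> t t' z /eqP -> /eqP ->.
  - move=> t z /andP[_ iC] /eqP tE; move: iC; rewrite {}tE iso_class_eq => /asboolP iz.
    have [nvE nhE] := isomorphic_size iz; have [_ _ _ eE pE] := isomorphic_invariants iz.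
    by rewrite /labelled_term eE pE nvE nhE.
rewrite sumr_const -cardsE /labelled_term /graph_weight coefZ coefXn eq_sym.
have := card_isomorphic_labelled ltg; rewrite -!/G; set A := finset _ => AE.
rewrite -AE natrM; have : #|A|%:R * #|automorphisms G|%:R != 0 :> rat.
  by rewrite -natrM AE pnatr_eq0 -lt0n muln_gt0 !fact_gt0.
rewrite mulf_eq0 negb_or => /andP[A0 aut0].
rewrite -[RHS]mulr_natl; move: (_ == _)%:R (\prod_v _) => b p.
by field; rewrite A0 aut0.
Qed.

Lemma coef_refined_chi :
  (refined_chi g 0)`_E =
  \sum_(t | closed_graph d (family_graph t)) labelled_term (family_graph t).
Proof.
have -> : refined_chi g 0 = \sum_(C <- family_classes) graph_weight (repr C).
  rewrite /refined_chi [RHS]fsbigop.fsbig_seq ?undup_uniq //.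
  apply: fsbigop.eq_fsbigl; apply/classical_sets.seteqP.
  by split=> C; rewrite /= mem_family_classes => /connected_stable_graphsE.
rewrite coef_sum big_seq.
under eq_bigr => C.
  rewrite mem_family_classes => cC; rewrite coef_graph_weight //.
over.
rewrite -big_seq (exchange_big_dep (fun t => closed_graph d (family_graph t))) /=; last first.
  by move=> ? ? _ /andP[].
apply: eq_bigr => t ct.
rewrite (eq_bigl (pred1 (\pi_iso_class (family_graph t)))) => [|C]; last first.
  by rewrite ct /= eq_sym.
rewrite -big_filter filter_pred1_uniq ?undup_uniq ?big_seq1 //.
by rewrite mem_family_classes (closed_graph_iso (isomorphic_repr _)).
Qed.

Lemma coef_refined_chi_count : (refined_chi g 0)`_E = graph_count (vertex_poly N) d 0 E.
Proof.
rewrite coef_refined_chi /graph_count.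
have ltE : (E.*2 + 0 < M')%N by rewrite addn0 ltnS leq_addl.
pose emb (p : {V : 'I_M & labelled_graph N V (E.*2 + 0)}) : labelled_family :=
  @family_embed (tag p) (Ordinal ltE) (tagged p).
transitivity (\sum_(t | closed_graph d (family_graph t) && (#|edges (family_graph t)| == E))
    labelled_term (family_graph t)).
  rewrite [RHS]big_mkcondr; apply: eq_bigr => t _; rewrite /labelled_term.
  by case: (_ == _); rewrite ?mul0r.
transitivity (\sum_(p : {V : 'I_M & labelled_graph N V (E.*2 + 0)} |
    true && closed_graph d (graph_of (tagged p)))
    (\prod_(v < tag p) chi_M ((val (tagged p)).1 v) #|[set h | (val (tagged p)).2.1 h == v]|) /
      ((tag p)`! * (E.*2 + 0)`!)%:R).
  have nhE G : closed_graph d G -> (#|edges G| == E) = (sg_nh G == E.*2 + 0)%N.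
    by move=> /and3P[_ /eqP lG _]; have := card_half_edges G; rewrite lG; lia.
  apply: (sum_correspondence (r := fun t p => t == emb p)).
  - case=> V [H z] /andP[ct]; rewrite nhE //= => /eqP HE.
    have {}HE : H = Ordinal ltE by apply: val_inj.
    move: z {ct}; rewrite {}HE => z.
    by exists (Tagged (fun V : 'I_M => labelled_graph N V (E.*2 + 0)) z).
  - by move=> p _; exists (emb p).
  - move=> t p /eqP ->; apply: andb_idr => cp; rewrite nhE //; exact: eqxx.
  - move=> t [V z] [V' z'] /eqP -> /eqP e.
    have VE : V = V' := congr1 tag e.
    by move: z' e; case: V' / VE => z' /family_embed_inj /= ->.
  - by move=> t t' z /eqP -> /eqP ->.
  - move=> t p /andP[_ /eqP eE] /eqP tE; rewrite /labelled_term eE eqxx mul1r tE /=.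
    congr (_ / _); apply: eq_bigr => v _; by rewrite ffunE.
rewrite -(sig_big_dep (fun=> true)
  (fun (V : 'I_M) (z : labelled_graph N V (E.*2 + 0)) => closed_graph d (graph_of z))
  (fun (V : 'I_M) (z : labelled_graph N V (E.*2 + 0)) =>
  (\prod_(v < V) chi_M ((val z).1 v) #|[set h | (val z).2.1 h == v]|) /
      (V`! * (E.*2 + 0)`!)%:R)) /=.
by apply: eq_bigr => V _; rewrite /graph_coef coef_graph_sum mulr_suml.
Qed.

End ClassSum.

Theorem theorem4p1 (g : nat) (hg : (3 <= g)%N) :
  refined_chi g 0 =
    (bernoulli (2 * g) / ((2 * g%:R) * (2 * g%:R - 2)))%:P +
    (1 / 2 : rat) *: poly_integral
      (kappa_op ((3 - 2 * g%:R)%:P + (2 : rat) *: 'X - (1 / 6)%:P)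
         (kappa_op (4 - 2 * g%:R)%:P (refined_chi (g - 1) 0)) +
       \sum_(2 <= r < g - 1)
         kappa_op (2 - 2 * r%:R)%:P (refined_chi r 0) *
         kappa_op (2 - 2 * g%:R + 2 * r%:R)%:P (refined_chi (g - r) 0)).
Proof.
pose N := g.+1; pose count := graph_count (vertex_poly N).
have rec : forall d n E, _ := graph_count_rec (vertex_poly_coef0 N).
have init_neq0 : forall d n, count d n 0 != 0 -> _ := @count_init_neq0 N.
have init : forall d n, _ = _ := fun d n => @count_init_rec N d n (ltac:(lia)).
have chiE r : (0 < r)%N -> (r <= g)%N -> refined_chi r 0 = closed_part count r.
  move=> r0 rg; apply/polyP => E.
  by rewrite (@coef_refined_chi_count N) // (coef_gf rec init_neq0).
rewrite !chiE; [|lia..].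
rewrite (closed_part_rec rec init_neq0 init) //; congr (_%:P + _ *: poly_integral (_ + _)).
  by rewrite [LHS]count_single_vertex ?chi_M_closed //; lia.
apply: eq_big_nat => r /andP[r2 rg]; rewrite !chiE //; lia.
Qed.
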